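(* Let $p$ be a fixed odd prime. The number of pairwise non-isotopic commutative semifields of order $p^n$, and the number of pairwise inequivalent planar DO mappings of $\mathbb{F}_{p^n}$, grow (at least) exponentially in $n$ for $n=4t$ with $t$ not a power of $2$: there are constants $C>0$ and $c>1$ (depending only on $p$) such that both numbers are at least $C\,c^{n}$ for every $n=4t$, $t$ a positive integer that is not a power of $2$.
   Context: A semifield is a finite set with operations $+,\circ$ such that addition is a group, $\circ$ is left and right distributive, $x\circ y=0$ implies $x=0$ or $y=0$, and there is a two-sided multiplicative identity. Two semifields on $\mathbb{F}_p^n$ with multiplications $\circ_1,\circ_2$ are isotopic if there are $\mathbb{F}_p$-linear bijections $N,L,M$ with $N(x\circ_1y)=L(x)\circ_2M(y)$ for all $x,y$. A Dembowski–Ostrom (DO) polynomial over $\mathbb{F}_{p^n}$ is $F(x)=\sum_{0\le i,j<n}a_{ij}x^{p^i+p^j}$; with $\Delta_F(x,y)=F(x+y)-F(x)-F(y)$, $F$ is planar if for every $a\in\mathbb{F}_{p^n}^\times$, $\Delta_F(x,a)=0$ implies $x=0$. Two planar DO polynomials $F,G$ are equivalent if $F=L_1\circ G\circ L_2$ for bijective $\mathbb{F}_p$-linear maps $L_1,L_2$ of $\mathbb{F}_{p^n}$. A power of $2$ means $2^j$ with $j\ge0$. *)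

(* Defs.v *)
From HB Require Import structures.
From mathcomp Require Import all_boot all_order perm all_algebra.
Set Implicit Arguments.
Unset Strict Implicit.
Unset Printing Implicit Defensive.
Import GRing.Theory.
Local Open Scope ring_scope.

(* The largest number of elements of [S] that are pairwise not related by [r];
   when [r] is an equivalence relation this is the number of its classes
   meeting [S]. *)
Definition num_pairwise_unrelated (T : finType) (r : rel T) (S : {set T}) : nat :=
  \max_(A : {set T} | (A \subset S) &&
          [forall x in A, forall y in A, (x != y) ==> ~~ r x y]) #|A|.

(* An additive group has at most one structure of ['F_p]-vector space, in which
   [c] acts as [x *+ c], with [c] read as a natural number below [p]. This
   covers both ['rV['F_p]_n] and a finite field of characteristic [p]. *)
Definition Fp_linear (p : nat) (V : finZmodType) (L : V -> V) : bool :=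
  [forall c : 'F_p, forall x, forall y, L (x *+ c + y) == L x *+ c + L y].

Section Semifields.
Variable V : finZmodType.
Implicit Type m : V -> V -> V.

Definition is_semifield m : bool :=
  [&& [forall x, forall y, forall z, m x (y + z) == m x y + m x z],
      [forall x, forall y, forall z, m (x + y) z == m x z + m y z],
      [forall x, forall y, (m x y == 0) ==> (x == 0) || (y == 0)]
    & [exists e, forall x, (m e x == x) && (m x e == x)]].

Definition is_commutative_semifield m : bool :=
  is_semifield m && [forall x, forall y, m x y == m y x].

Definition isotopic (p : nat) m1 m2 : bool :=
  [exists N : {perm V}, exists L : {perm V}, exists M : {perm V},
    [&& Fp_linear p N, Fp_linear p L, Fp_linear p M
      & [forall x, forall y, N (m1 x y) == m2 (L x) (M y)]]].

End Semifields.

(* A semifield of order [p ^ n] has an elementary abelian additive group, so it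
   is, up to isomorphism, a multiplication on ['F_p ^ n]. *)
Definition num_commutative_semifields (p n : nat) : nat :=
  num_pairwise_unrelated
    (fun m1 m2 : {ffun 'rV['F_p]_n * 'rV['F_p]_n -> 'rV['F_p]_n} =>
       isotopic p (fun x y => m1 (x, y)) (fun x y => m2 (x, y)))
    [set m : {ffun 'rV['F_p]_n * 'rV['F_p]_n -> 'rV['F_p]_n} |
       is_commutative_semifield (fun x y => m (x, y))].

Section PlanarDO.
Variables (p n : nat) (K : finFieldType).
Implicit Types f g : {ffun K -> K}.

(* For [#|K| = p ^ n] with [p] odd, the exponents are below [#|K|], so a DO
   polynomial and the mapping it induces determine each other. *)
Definition is_DO f : bool :=
  [exists a : 'M[K]_n, forall x,
    f x == \sum_(i < n) \sum_(j < n) a i j * x ^+ (p ^ i + p ^ j)].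

Definition Delta f (x y : K) : K := f (x + y) - f x - f y.

Definition is_planar f : bool :=
  [forall a, (a != 0) ==> [forall x, (Delta f x a == 0) ==> (x == 0)]].

Definition DO_equivalent f g : bool :=
  [exists L1 : {perm K}, exists L2 : {perm K},
    [&& Fp_linear p L1, Fp_linear p L2 & [forall x, f x == L1 (g (L2 x))]]].

Definition num_planar_DO : nat :=
  num_pairwise_unrelated DO_equivalent [set f | is_DO f && is_planar f].

End PlanarDO.

(* Main.v *)
From HB Require Import structures.
Require Import Defs.
From mathcomp Require Import all_boot all_order all_algebra.
From mathcomp Require Import all_fingroup all_solvable all_field.
From mathcomp Require Import reals.
From mathcomp Require Import zify ring lra.
Set Implicit Arguments.
Unset Strict Implicit.
Unset Printing Implicit Defensive.
Import Order.TTheory GRing.Theory Num.Theory VectorInternalTheory.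
Local Open Scope ring_scope.

(** Write n = 4t and m = 2t, and let K be the field with p^m elements. Since t is
    not a power of 2 it has an odd divisor d > 1, say t = d s, and K carries an
    automorphism sig : x -> x^(p^(2s)) of odd order d besides the involution
    bar : x -> x^(p^t). Fix a nonsquare B of K. For every nonzero a fixed by bar, with
    rho = bar sig, the product of (x, y) and (u, v) defined as
      (sig x u + x sig u + B (sig y v + y sig v),
       rho x v + rho u y + (a / B) (x rho v + u rho y))
    is biadditive and commutative on K x K, and it has no zero divisors
    ([semifield_mul_eq0]): elements fixed by bar, elements of norm 1 and -1 are squares,
    and a zero divisor would make a square equal to a nonsquare. These are p^t - 1
    products, and it is enough to show that an isotopy class contains at most 4m of them
    ([card_isotopic_parameters]).

    The scalars, X -> cX on both arguments, are autotopisms of every product of the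
    family. Zsigmondy's theorem ([primitive_prime_divisor]) gives a prime l that divides
    p^m - 1 but no p^i - 1 with 0 < i < m. Let Z be the Sylow l-subgroup of the scalars.
    As Z generates K as a ring, whatever normalizes Z is semilinear over K
    ([normalizer_semilinear]). A K-linear isotopism between two members of the family
    preserves or exchanges the two coordinates ([linear_shape]), and comparing
    coefficients determines it almost completely ([diagonal_isotopism]). One
    consequence is that every autotopism normalizing Z has a power that is a scalar,
    with an exponent prime to l; so Z is a Sylow subgroup of its normalizer, hence of the
    whole autotopism group ([scalars_Sylow]). By Sylow's theorem, an arbitrary isotopism
    can then be corrected by an autotopism into one that normalizes Z, that is, into a
    semilinear one ([isotopism_semilinear]). The other consequence is that, for
    semilinear isotopisms, the second parameter is known up to sign from the first one,
    the field automorphism (m choices) and the permutation of the coordinates.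

    Choosing one parameter per isotopy class leaves at least (p^t - 1) / (8t) pairwise
    non-isotopic products. Kaplansky's trick turns them into semifields
    ([num_commutative_semifields_ge]). Their squares X -> X * X are planar, they are DO
    maps because every biadditive map of a finite field is a polynomial with
    exponents p^i and p^j ([biadditive_polynomial]), and polarization turns equivalent
    squares into isotopic products ([num_planar_DO_ge]). *)

(** * Primitive prime divisors of p^m - 1 *)

Section PrimitivePrimeDivisors.
Local Open Scope nat_scope.

Definition Cyclotomic_value (m p : nat) : nat := absz ('Phi_m).[p%:Z]%R.

(** The value is the product of the distances from p to the primitive m-th roots of
    unity, and each of these distances is at least p - 1. *)
Lemma Cyclotomic_value_ge (m p : nat) : 0 < m -> 0 < p ->
  p.-1 ^ totient m <= Cyclotomic_value m p.
Proof.
move=> m_gt0 p_gt0.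
have [z z_prim] := C_prim_root_exists m_gt0.
have z_norm : `|z|%R = 1%R :> algC.
  apply/eqP; rewrite -(@pexpr_eq1 _ _ m) // ?normr_ge0 //.
  by rewrite -normrX prim_expr_order ?normr1.
have norm_ge (k : nat) : ((p.-1)%:R <= `|p%:R - z ^+ k| :> algC)%R.
  apply: le_trans (lerB_dist _ _).
  by rewrite normrX z_norm expr1n normr_nat -[p in X in (_ <= X)%R]prednK // -natr1 addrK.
rewrite -(ler_nat algC) natrX.
have -> : ((Cyclotomic_value m p)%:R = `|(cyclotomic z m).[p%:R]| :> algC)%R.
  rewrite -(Cintr_Cyclotomic z_prim) (_ : p%:R = (p%:Z)%:~R)%R // horner_map.
  by rewrite -[LHS]/((Cyclotomic_value m p)%:Z%:~R)%R abszE intr_norm.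
rewrite /cyclotomic horner_prod normr_prod.
have -> : (totient m = \sum_(k < m | coprime k m) 1)%N.
  rewrite totient_count_coprime big_mkord [RHS]big_mkcond /=.
  by apply: eq_bigr => i; rewrite coprime_sym.
rewrite expr_sum; apply: ler_prod => k _.
by rewrite hornerXsubC ler0n expr1 norm_ge.
Qed.

(** The cyclotomic factors of X^e - 1 are among those of X^m - 1, and 'Phi_m is not one
    of them. *)
Lemma Cyclotomic_value_dvd (m e p : nat) : 0 < m -> e %| m -> e < m ->
  Cyclotomic_value m p * (p ^ e).-1 %| (p ^ m).-1.
Proof.
move=> m_gt0 e_dvd e_lt.
have e_gt0 := dvdn_gt0 m_gt0 e_dvd.
have [-> | p_gt0] := posnP p; first by rewrite !exp0n // dvdn0.
pose others : {poly int} := (\prod_(d <- divisors m | (d != m) && ~~ (d %| e)%N) 'Phi_d)%R.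
have factored : ('X^m - 1 = 'Phi_m * ('X^e - 1) * others :> {poly int})%R.
  rewrite -!prod_Cyclotomic // (bigD1_seq m) ?divisors_uniq ?divisors_id //=.
  rewrite (bigID (fun d => d %| e)) /= mulrA; congr (_ * _ * _)%R.
  rewrite -big_filter; apply: perm_big; apply: uniq_perm.
  - by rewrite filter_uniq ?divisors_uniq.
  - exact: divisors_uniq.
  move=> d; rewrite mem_filter -!dvdn_divisors //.
  apply/andP/idP => [[/andP[_ ->]] // | d_e]; split; last exact: dvdn_trans e_dvd.
  by rewrite d_e andbT; apply: contraTneq e_lt => <-; rewrite -leqNgt dvdn_leq.
have powB1 i : (absz (p%:Z ^+ i - 1)%R) = (p ^ i).-1.
  by rewrite -!natz -natrX !natz -predn_int ?expn_gt0 ?p_gt0.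
move/(congr1 (fun f : {poly int} => absz f.[p%:Z]%R)): factored.
by rewrite !hornerM !hornerE !abszM !powB1 => ->; rewrite dvdn_mulr.
Qed.

Lemma sum_expn_mod (x s l : nat) : x = 1 %[mod l] ->
  \sum_(j < s) x ^ j = s %[mod l].
Proof.
move=> x1; rewrite -modn_summ (eq_bigr (fun=> 1 %% l)).
  by rewrite modn_summ sum_nat_const card_ord muln1.
by move=> j _; rewrite -modnXm x1 modnXm exp1n.
Qed.

(** With x = 1 + l y, the binomial formula gives x^j = 1 + j l y modulo l^2, and the sum
    of the j < l is divisible by l because l is odd. *)
Lemma sum_expn_mod_sqr (x l : nat) : prime l -> odd l -> x = 1 %[mod l] -> 0 < x ->
  \sum_(j < l) x ^ j = l %[mod l ^ 2].
Proof.
move=> l_pr l_odd x1 x_gt0.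
have [y def_x] : exists y, x = (l * y).+1.
  exists (x.-1 %/ l); rewrite mulnC divnK ?prednK //.
  by rewrite -subn1 -eqn_mod_dvd // eq_sym; apply/eqP; rewrite x1.
have l_gt2 : 2 < l by rewrite odd_prime_gt2.
have pow_mod j : x ^ j = 1 + j * (l * y) %[mod l ^ 2].
  elim: j => [|j IHj]; first by rewrite mul0n.
  rewrite expnS -modnMmr IHj modnMmr def_x.
  have -> : (l * y).+1 * (1 + j * (l * y)) = (j * y ^ 2) * l ^ 2 + (1 + j.+1 * (l * y)).
    by rewrite !mulSn; ring.
  by rewrite modnMDl.
rewrite -modn_summ (eq_bigr (fun j : 'I_l => (1 + j * (l * y)) %% l ^ 2)); last first.
  by move=> j _; rewrite pow_mod.
rewrite modn_summ big_split /= sum_nat_const card_ord muln1 -big_distrl /=.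
have -> : \sum_(i < l) i = 'C(l, 2) by rewrite -bin2_sum big_mkord.
have /dvdnP[w ->] : l %| 'C(l, 2) by apply: prime_dvd_bin.
have -> : l + w * l * (l * y) = (w * y) * l ^ 2 + l by ring.
by rewrite modnMDl.
Qed.

Lemma expn_eq1_Fp (p l i : nat) : 0 < p -> prime l ->
  (p%:R ^+ i == 1 :> 'F_l)%R = (l %| (p ^ i).-1).
Proof.
move=> p_gt0 l_pr.
rewrite (dvdn_pcharf (pchar_Fp l_pr)) -natrX -[in LHS](prednK (n := p ^ i)) ?expn_gt0 ?p_gt0 //.
by rewrite -natr1 -subr_eq0 addrK.
Qed.

Lemma primitive_root_Fp_lt (o l : nat) (a : 'F_l) :
  prime l -> (o.-primitive_root a)%R -> o < l.
Proof.
move=> l_pr o_prim; have o_gt0 := prim_order_gt0 o_prim.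
have a_nz : (a != 0)%R.
  apply: contra_eq_neq (prim_expr_order o_prim) => ->.
  by rewrite expr0n (gtn_eqF o_gt0) eq_sym oner_neq0.
have : o %| l.-1.
  rewrite (prim_order_dvd o_prim) -(inj_eq (mulfI a_nz)) -exprS prednK ?prime_gt0 //.
  by have := expf_card a; rewrite card_Fp // mulr1 => ->.
by move/dvdn_leq; have := prime_gt1 l_pr; lia.
Qed.

(** Let o < m be the order of p modulo l. For each prime s dividing m / o, l divides the
    sum of the s powers of p^(m/s), which is s modulo l; hence s = l, and m / o is a
    power of l. Taking s = l and reducing modulo l^2 shows that l divides the cyclotomic
    value only once. *)
Lemma Cyclotomic_value_prime_factor (m p l : nat) :
    2 < p -> (forall j, m <> 2 ^ j) -> 0 < m ->
    prime l -> l %| Cyclotomic_value m p -> ~~ (m.-primitive_root (p%:R : 'F_l))%R ->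
  (exists o j, m = o * l ^ j.+1 /\ 0 < o < l) /\
  2 < l /\ ~~ (l ^ 2 %| Cyclotomic_value m p).
Proof.
move=> p_gt2 m_n2 m_gt0 l_pr l_n no_prim.
set n := Cyclotomic_value m p in l_n *.
have p_gt0 : 0 < p by lia.
have n_sum e s : m = e * s -> 1 < s -> 0 < e -> n %| \sum_(j < s) (p ^ e) ^ j.
  move=> def_m s_gt1 e_gt0.
  have := @Cyclotomic_value_dvd m e p m_gt0.
  rewrite {1 2}def_m dvdn_mulr // -{1}(muln1 e) ltn_pmul2l // => /(_ isT s_gt1).
  rewrite -/n {1}def_m expnM (predn_exp (p ^ e)) mulnC dvdn_pmul2l // -subn1 subn_gt0.
  by rewrite -(expn0 p) ltn_exp2l //; lia.
have p_m : (p%:R ^+ m = 1 :> 'F_l)%R.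
  apply/eqP; rewrite expn_eq1_Fp //; apply: dvdn_trans l_n _.
  apply: dvdn_trans (@Cyclotomic_value_dvd m 1 p m_gt0 (dvd1n _) _).
    exact: dvdn_mulr.
  by have := m_n2 0; rewrite expn0; lia.
have [o o_prim o_m] := prim_order_exists m_gt0 p_m.
have o_gt0 : 0 < o by apply: dvdn_gt0 o_m.
have o_lt_l : o < l by apply: primitive_root_Fp_lt o_prim.
have p_mod i : o %| i -> p ^ i = 1 %[mod l].
  rewrite (prim_order_dvd o_prim) expn_eq1_Fp // => l_dvd.
  by apply/eqP; rewrite eqn_mod_dvd ?expn_gt0 ?p_gt0 // subn1.
have [w def_m] := dvdnP o_m.
have w_gt0 : 0 < w by move: m_gt0; rewrite def_m muln_gt0 => /andP[].
have w_gt1 : 1 < w.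
  rewrite ltn_neqAle w_gt0 andbT; apply: contraNneq no_prim => w1.
  by move: o_prim; rewrite def_m -w1 mul1n.
have w_nat : l.-nat w.
  apply/pnatP => // s s_pr /dvdnP[v def_w].
  have : l %| \sum_(j < s) (p ^ (o * v)) ^ j.
    apply: dvdn_trans l_n (n_sum _ _ _ (prime_gt1 s_pr) _).
      by rewrite def_m def_w; ring.
    by rewrite muln_gt0 o_gt0; move: w_gt0; rewrite def_w muln_gt0 => /andP[].
  rewrite /dvdn (sum_expn_mod _ (p_mod _ (dvdn_mulr _ (dvdnn _)))) -/(l %| s).
  by rewrite dvdn_prime2 // eq_sym.
have [j def_w] := p_natP w_nat.
case: j def_w => [|j] def_w; first by rewrite def_w in w_gt1.
have l_gt2 : 2 < l.
  rewrite ltn_neqAle prime_gt1 // andbT; apply/eqP => l2; apply: (m_n2 j.+1).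
  by rewrite def_m def_w -l2 (_ : o = 1) ?muln1 //; lia.
split; first by exists o, j; rewrite o_gt0 o_lt_l def_m def_w mulnC.
split=> //; apply/negP => l2_n.
have : l ^ 2 %| \sum_(i < l) (p ^ (o * l ^ j)) ^ i.
  apply: dvdn_trans l2_n (n_sum _ _ _ (prime_gt1 l_pr) _).
    by rewrite def_m def_w expnS; ring.
  by rewrite muln_gt0 o_gt0 expn_gt0 prime_gt0.
have l_odd : odd l by case: (even_prime l_pr) => // l2; rewrite l2 in l_gt2.
rewrite /dvdn sum_expn_mod_sqr // ?expn_gt0 ?p_gt0 // ?p_mod ?dvdn_mulr //.
by rewrite modn_small ?eqn0Ngt ?prime_gt0 // -{1}(expn1 l) ltn_exp2l // prime_gt1.
Qed.

(** Zsigmondy's theorem for p > 2. If no prime factor of 'Phi_m(p) is primitive, each one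
    is the largest prime factor of m and occurs once, so that 'Phi_m(p) is a prime l
    dividing m. But then 'Phi_m(p) is at least 2^(l - 1), which exceeds l > 2. *)
Lemma primitive_prime_divisor (m p : nat) : 2 < p -> (forall j, m <> 2 ^ j) -> 0 < m ->
  exists2 l, prime l & (m.-primitive_root (p%:R : 'F_l))%R.
Proof.
move=> p_gt2 m_n2 m_gt0.
set n := Cyclotomic_value m p.
have n_ge : 2 ^ totient m <= n.
  apply: leq_trans (Cyclotomic_value_ge m_gt0 _); last by lia.
  by rewrite leq_exp2r ?totient_gt0 //; lia.
have n_gt1 : 1 < n.
  by apply: leq_trans n_ge; rewrite -{1}(expn0 2) ltn_exp2l // totient_gt0.
case: (boolP (has (fun l => (m.-primitive_root (p%:R : 'F_l))%R) (primes n))) => [/hasP[l]|].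
  by rewrite mem_primes => /andP[l_pr _]; exists l.
move/hasPn => no_prim.
have factor l : prime l -> l %| n ->
    (exists o j, m = o * l ^ j.+1 /\ 0 < o < l) /\ 2 < l /\ ~~ (l ^ 2 %| n).
  move=> l_pr l_n; apply: Cyclotomic_value_prime_factor => //; apply: no_prim.
  by rewrite mem_primes l_pr l_n andbT ltnW.
pose l := pdiv n; have l_pr : prime l by apply: pdiv_prime.
have l_n : l %| n by apply: pdiv_dvd.
have [[o [j [def_m /andP[o_gt0 o_lt]]]] [l_gt2 l2_n]] := factor l l_pr l_n.
(* Two such prime factors of n would each be at most the other one. *)
have n_nat : l.-nat n.
  apply/pnatP => [|l' l'_pr l'_n]; first exact: ltnW.
  have [[o' [j' [def_m' /andP[o'_gt0 o'_lt]]]] _] := factor l' l'_pr l'_n.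
  have dvd_le r r' b b' i i' : prime r -> prime r' -> 0 < b' -> m = b * r ^ i.+1 ->
      m = b' * r' ^ i'.+1 -> b' < r' -> r <= r'.
    move=> r_pr r'_pr b'_gt0 m1 m2 b'_lt.
    have : r %| b' * r' ^ i'.+1 by rewrite -m2 m1 expnS mulnCA dvdn_mulr.
    rewrite Euclid_dvdM // => /orP[/(dvdn_leq b'_gt0) | ]; first by lia.
    by rewrite Euclid_dvdX // andbT dvdn_prime2 // => /eqP->.
  rewrite inE; apply/eqP/anti_leq.
  by rewrite (dvd_le _ _ _ _ _ _ _ _ _ def_m' def_m) // (dvd_le _ _ _ _ _ _ _ _ _ def_m def_m').
have [k def_n] := p_natP n_nat.
have {k}def_n : n = l.
  case: k def_n => [|[|k]] def_n; [by rewrite def_n in n_gt1 | by rewrite def_n expn1|].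
  by case/negP: l2_n; rewrite def_n dvdn_exp2l.
have totient_ge : l.-1 <= totient m.
  have o_l : coprime o l.
    by rewrite coprime_sym prime_coprime //; apply: contraL o_lt => /(dvdn_leq o_gt0); lia.
  rewrite def_m totient_coprime ?coprimeXr // totient_pfactor // mulnCA leq_pmulr //.
  by rewrite muln_gt0 totient_gt0 o_gt0 expn_gt0 prime_gt0.
have : 2 ^ l.-1 <= l by rewrite -[X in _ <= X]def_n (leq_trans _ n_ge) // leq_exp2l.
have -> : l.-1 = l.-2.+1 by lia.
by rewrite expnS; have := ltn_expl l.-2 (isT : 1 < 2); lia.
Qed.

End PrimitivePrimeDivisors.

(** * Frobenius maps of a finite field *)

Lemma finField_primitive_root (K : finFieldType) : exists z : K, (#|K|.-1).-primitive_root z.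
Proof.
have c_gt1 : (1 < #|K|)%N := finNzRing_gt1 K.
have n_gt0 : (0 < #|K|.-1)%N by rewrite -ltnS prednK // ltnW.
pose rs := [seq x <- enum K | x != 0].
suff /hasP[z _ z_prim] : has (#|K|.-1).-primitive_root rs by exists z.
apply: has_prim_root => //.
- apply/allP => x; rewrite mem_filter => /andP[x_nz _].
  rewrite unity_rootE; apply/eqP/(mulfI x_nz).
  by rewrite -exprS prednK ?expf_card ?mulr1 // ltnW.
- by rewrite filter_uniq ?enum_uniq.
rewrite size_filter -[X in (_ <= X)%N](addKn (count (pred1 0) (enum K))).
by rewrite (count_predC (pred1 0)) count_uniq_mem ?enum_uniq // mem_enum -cardE subn1.
Qed.

(** The proof argument lets the ring morphism structure be inferred. *)
Definition frob (K : finFieldType) (p : nat) of p \in [pchar K] :=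
  fun (i : nat) (x : K) => x ^+ (p ^ i).

Section FrobeniusMorphism.
Variables (K : finFieldType) (p : nat) (charK : p \in [pchar K]).

Fact frob_zmod_morphism i : zmod_morphism (frob charK i).
Proof.
elim: i => [|i IHi] x y; first by rewrite /frob !expr1.
rewrite /frob expnSr !exprM; have := IHi x y; rewrite /frob => ->.
by rewrite -!(pFrobenius_autE charK) rmorphB.
Qed.

Fact frob_monoid_morphism i : monoid_morphism (frob charK i).
Proof. by split=> [|x y]; rewrite /frob ?expr1n ?exprMn. Qed.

HB.instance Definition _ i :=
  GRing.isZmodMorphism.Build K K (frob charK i) (frob_zmod_morphism i).
HB.instance Definition _ i :=
  GRing.isMonoidMorphism.Build K K (frob charK i) (frob_monoid_morphism i).

Lemma natr_inj_lt (i j : nat) : (i < p)%N -> (j < p)%N -> i%:R = j%:R :> K -> i = j.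
Proof.
wlog le_ij : i j / (i <= j)%N.
  by move=> wl i_lt j_lt e; case/orP: (leq_total i j) => ij; [|symmetry]; apply: wl.
move=> i_lt j_lt /eqP; rewrite eq_sym -subr_eq0 -natrB // -(dvdn_pcharf charK).
by move=> /dvdnP[[|k]]; lia.
Qed.

Lemma frob_fix_nat (x : K) : x ^+ p = x -> exists n : nat, x = n%:R.
Proof.
have p_pr := pcharf_prime charK; move=> xp.
pose rs : seq K := [seq (n%:R : K) | n <- iota 0 p].
have [/mapP[n _ ->]|x_notin] := boolP (x \in rs); first by exists n.
pose P : {poly K} := 'X^p - 'X.
have size_P : size P = p.+1.
  by rewrite size_polyDl size_polyXn // size_polyN size_polyX ltnS prime_gt1.
have P_nz : P != 0 by rewrite -size_poly_eq0 size_P.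
have rootP_ y : root P y = (y ^+ p == y) by rewrite /root !hornerE subr_eq0.
suff : (size (x :: rs) < size P)%N by rewrite size_P /= size_map size_iota ltnn.
apply: max_poly_roots => //=.
  rewrite rootP_ xp eqxx /=; apply/allP => _ /mapP[n _ ->].
  by rewrite rootP_ -(pFrobenius_autE charK) pFrobenius_aut_nat.
rewrite x_notin /= map_inj_in_uniq ?iota_uniq // => i j.
by rewrite !mem_iota /= !add0n; apply: natr_inj_lt.
Qed.

(** Let z generate the multiplicative group. The polynomial whose roots are the
    z^(p^i) has coefficients fixed by the Frobenius map, hence in the prime field; so it
    is fixed by tau, and tau sends z to another of its roots. *)
Lemma finField_rmorphism (m : nat) (tau : {rmorphism K -> K}) : #|K| = (p ^ m)%N ->
  exists i : 'I_m, forall x, tau x = x ^+ (p ^ i).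
Proof.
move=> cardK; have p_pr := pcharf_prime charK.
have c_gt1 : (1 < #|K|)%N := finNzRing_gt1 K.
have [z z_prim] := finField_primitive_root K.
pose f : {poly K} := \prod_(i < m) ('X - (frob charK i z)%:P).
have m_gt0 : (0 < m)%N by move: c_gt1; rewrite cardK; case: (m).
have f_frob : map_poly (frob charK 1) f = f.
  rewrite /f rmorph_prod; clear f; case: m m_gt0 cardK => // m' _ cardK.
  rewrite (eq_bigr (fun i : 'I_m'.+1 => 'X - (frob charK i.+1 z)%:P)); last first.
    by move=> i _; rewrite rmorphB /= map_polyX map_polyC /= /frob expn1 -exprM -expnSr.
  rewrite big_ord_recr big_ord_recl /= mulrC; congr (_ * _).
  by rewrite /frob -cardK expf_card expr1.
have f_tau : map_poly tau f = f.
  apply/polyP => i; rewrite coef_map /=.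
  have [|n ->] := @frob_fix_nat f`_i; last by rewrite rmorph_nat.
  by have := congr1 (fun g : {poly K} => g`_i) f_frob; rewrite coef_map /= /frob expn1.
have : root f (tau z).
  rewrite -f_tau rmorph_root // /f /root horner_prod.
  by apply/prodf_eq0; exists (Ordinal m_gt0) => //; rewrite hornerXsubC /frob expr1 subrr.
rewrite /root horner_prod => /prodf_eq0[i _]; rewrite hornerXsubC subr_eq0 => /eqP tau_z.
exists i => x; have [-> | x_nz] := eqVneq x 0.
  by rewrite rmorph0 expr0n gtn_eqF // expn_gt0 prime_gt0.
have x_unity : x ^+ #|K|.-1 = 1.
  by apply: (mulfI x_nz); rewrite -exprS prednK ?expf_card ?mulr1 // ltnW.
have [j ->] := prim_rootP z_prim x_unity.
by rewrite rmorphXn tau_z /frob -!exprM mulnC.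
Qed.

(** The powers of lam up to the exponent m - 1 are independent over the prime field: a
    relation would be a polynomial of degree less than m with the m roots lam^(p^i).
    Hence they have p^m combinations. *)
Lemma subring_full (m : nat) (lam : K) (R : {pred K}) : #|K| = (p ^ m)%N ->
    (forall i, lam ^+ (p ^ i) = lam -> (m %| i)%N) ->
    lam \in R -> 0 \in R -> 1 \in R ->
    (forall x y, x \in R -> y \in R -> x + y \in R) ->
    (forall x y, x \in R -> y \in R -> x * y \in R) ->
  forall x, x \in R.
Proof.
move=> cardK lam_free lamR R0 R1 RD RM.
have p_pr := pcharf_prime charK.
pose F (a : {ffun 'I_m -> 'I_p}) : K := \sum_(i < m) (a i)%:R * lam ^+ i.
have natR n : n%:R \in R by elim: n => // n IHn; rewrite -natr1 RD.
have powR n : lam ^+ n \in R by elim: n => // n IHn; rewrite exprS RM.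
have FR a : F a \in R.
  by apply: (big_ind (fun x => x \in R)) => // i _; rewrite RM.
have F_inj : injective F.
  move=> a b eq_ab.
  (* E extends the coefficient of the difference by 0 to all naturals. *)
  pose E i : K := if insub i is Some k then (a k)%:R - (b k)%:R else 0.
  have E_val (k : 'I_m) : E k = (a k)%:R - (b k)%:R by rewrite /E valK.
  pose P := \poly_(i < m) E i.
  have P_root : root P lam.
    rewrite /root horner_poly (eq_bigr (fun i : 'I_m => (a i)%:R * lam ^+ i - (b i)%:R * lam ^+ i)).
      by rewrite sumrB -/(F a) -/(F b) eq_ab subrr.
    by move=> i _; rewrite E_val mulrBl.
  have P_frob i : map_poly (frob charK i) P = P.
    apply/polyP => j; rewrite coef_map /= coef_poly; case: ifP => _; last by rewrite rmorph0.
    by rewrite /E; case: insub => [k|]; rewrite ?rmorph0 // rmorphB !rmorph_nat.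
  have P0 : P = 0.
    apply: (@roots_geq_poly_eq0 _ P [seq lam ^+ (p ^ i) | i <- iota 0 m]).
    - apply/allP => _ /mapP[i _ ->]; rewrite -/(frob charK i lam) -(P_frob i).
      exact: rmorph_root.
    - rewrite map_inj_in_uniq ?iota_uniq // => i j.
      rewrite !mem_iota /= !add0n.
      wlog le_ij : i j / (i <= j)%N.
        by move=> wl i_lt j_lt e; case/orP: (leq_total i j) => ij; [|symmetry]; apply: wl.
      move=> i_lt j_lt e; have : frob charK i lam = frob charK i (lam ^+ (p ^ (j - i))).
        by rewrite /frob -exprM -expnD subnK.
      by move/fmorph_inj/esym/lam_free/dvdnP=> [[|k]]; lia.
    by rewrite size_map size_iota size_poly.
  apply/ffunP => k; apply/val_inj; have := congr1 (fun g : {poly K} => g`_k) P0.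
  rewrite coef_poly coef0 ltn_ord E_val => /eqP; rewrite subr_eq0 => /eqP.
  exact: natr_inj_lt.
suff imF : codom F =i predT.
  by move=> x; have := imF x; rewrite inE => /codomP[a ->].
apply/subset_cardP; last exact: subset_predT.
by rewrite card_codom // card_ffun !card_ord -cardK.
Qed.

End FrobeniusMorphism.

(** * The family of multiplications *)

(** By Euler's criterion, quad_char x = -1 says that x is not a square. *)
Definition quad_char (K : finFieldType) (x : K) : K := x ^+ (#|K|.-1)./2.

(** The properties of the two field automorphisms from which all computations with the
    multiplications follow. The last two say that the elements fixed by bar and those of
    norm 1 are squares; sig2_fix is what remains of the odd order of sig. *)
Record twist_pair (K : finFieldType) (sig bar : {rmorphism K -> K}) : Prop := TwistPair {
  odd_card : odd #|K|;
  two_neq0 : 2 != 0 :> K;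
  sig_bar : forall x, sig (bar x) = bar (sig x);
  bar_bar : forall x, bar (bar x) = x;
  sig2_fix : forall x, sig (sig x) = x -> sig x = x;
  sig_fix_not_bar : exists2 x, sig x = x & bar x != x;
  sig_not_id : exists x, sig x != x;
  quad_char_bar_fix : forall x, x != 0 -> bar x = x -> quad_char x = 1;
  quad_char_norm1 : forall x, x * bar x = 1 -> quad_char x = 1
}.

(** The parameter a of the family is c * B; the pair (B, c) is more convenient, as
    exchanging the coordinates replaces it with the pair of the inverses. *)
Definition semifield_mul (K : finFieldType) (sig bar : {rmorphism K -> K})
    (B c : K) (X Y : K * K) : K * K :=
  (sig X.1 * Y.1 + X.1 * sig Y.1 + B * (sig X.2 * Y.2 + X.2 * sig Y.2),
   bar (sig X.1) * Y.2 + bar (sig Y.1) * X.2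
     + c * (X.1 * bar (sig Y.2) + Y.1 * bar (sig X.2))).

Arguments semifield_mul : simpl never.

Section TwistedMultiplication.
Variables (K : finFieldType) (sig bar : {rmorphism K -> K}).
Hypothesis tw : twist_pair sig bar.
Implicit Types x y z u v w B c a : K.
Local Notation rho x := (bar (sig x)).
Local Notation chi := (@quad_char K).
Local Notation "X *[ B , c ] Y" := (semifield_mul sig bar B c X Y)
  (at level 40, B at next level, c at next level, format "X  *[ B ,  c ]  Y").

Lemma chiM x y : chi (x * y) = chi x * chi y.
Proof. exact: exprMn. Qed.

Lemma card_gt2 : (2 < #|K|)%N.
Proof.
have c_gt1 : (1 < #|K|)%N := finNzRing_gt1 K; have := odd_card tw.
by rewrite ltn_neqAle c_gt1 andbT; case: eqP => // <-.
Qed.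

Lemma chiV x : chi x^-1 = (chi x)^-1.
Proof. exact: exprVn. Qed.

Lemma chi_neq0 x : chi x = -1 -> x != 0.
Proof.
move=> chi_x; apply/eqP => x0; move: chi_x; rewrite x0 /quad_char expr0n gtn_eqF.
  by move/eqP; rewrite eq_sym oppr_eq0 oner_eq0.
by rewrite half_gt0 -ltnS prednK ?card_gt2 // ltnW // ltnW // card_gt2.
Qed.

Lemma one_neqN1 : 1 != -1 :> K.
Proof. by rewrite -subr_eq0 opprK (two_neq0 tw). Qed.

Lemma chi_bar_fix x : x != 0 -> bar x = x -> chi x = 1.
Proof. exact: (quad_char_bar_fix tw). Qed.

Lemma chiN x : chi (- x) = chi x.
Proof.
by rewrite -mulN1r chiM chi_bar_fix ?mul1r // ?oppr_eq0 ?oner_eq0 ?rmorphN1.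
Qed.

Lemma chi_sqr x : x != 0 -> chi x * chi x = 1.
Proof.
move=> x_nz; rewrite -expr2 -exprM.
have -> : ((#|K|.-1)./2 * 2 = #|K|.-1)%N.
  by rewrite muln2 even_halfK // -subn1 oddB ?(odd_card tw) // ltnW ?card_gt2 // ltnW ?card_gt2.
apply: (mulfI x_nz); rewrite -exprS prednK ?expf_card ?mulr1 //.
by apply: ltnW; apply: finNzRing_gt1.
Qed.

Lemma chi_cases x : x != 0 -> chi x = 1 \/ chi x = -1.
Proof.
by move/chi_sqr/eqP; rewrite -expr2 sqrf_eq1 => /orP[] /eqP ->; [left | right].
Qed.

Lemma chi_rmorph (f : {rmorphism K -> K}) x : chi (f x) = chi x.
Proof.
have [-> | x_nz] := eqVneq x 0; first by rewrite rmorph0.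
rewrite {1}/quad_char -rmorphXn -/(quad_char x).
by case: (chi_cases x_nz) => ->; rewrite ?rmorphN1 ?rmorph1.
Qed.

Lemma sig_opp x : sig x = - x -> x = 0.
Proof.
move=> sx; have : sig x = x by apply: (sig2_fix tw); rewrite sx rmorphN sx opprK.
rewrite sx => /eqP; rewrite eq_sym -subr_eq0 opprK -mulr2n -mulr_natl mulf_eq0.
by rewrite (negPf (two_neq0 tw)) => /eqP.
Qed.

Lemma sig_add_eq0 x u : u != 0 -> sig x * u + x * sig u = 0 -> x = 0.
Proof.
move=> u_nz e0.
have su_nz : sig u != 0 by rewrite fmorph_eq0.
suff /sig_opp/eqP : sig (x / u) = - (x / u).
  by rewrite mulf_eq0 invr_eq0 (negPf u_nz) orbF => /eqP.
rewrite fmorph_div; apply/eqP; rewrite -subr_eq0 opprK addf_div //.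
by rewrite e0 mul0r.
Qed.

Definition admissible B c : Prop := [/\ chi B = -1, c * B != 0 & bar (c * B) = c * B].

Lemma admissible_chi B c : admissible B c -> chi c = -1.
Proof.
case=> chiB cB_nz cB_fix; have := chi_bar_fix cB_nz cB_fix.
by rewrite chiM chiB mulrN1 => /eqP; rewrite eqr_oppLR => /eqP.
Qed.

Lemma rho_skew_eq0 c w : chi c = -1 -> rho w = - (c * w) -> w = 0.
Proof.
move=> chi_c e; apply/eqP; apply: contraTT isT => w_nz.
have : chi (rho w) = - chi w by rewrite e chiN chiM chi_c mulN1r.
rewrite !chi_rmorph => /eqP.
by case: (chi_cases w_nz) => ->; rewrite ?opprK ?(negPf one_neqN1) // eq_sym (negPf one_neqN1).
Qed.

Lemma rho_rho x : rho (rho x) = sig (sig x).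
Proof. by rewrite (sig_bar tw) (bar_bar tw). Qed.

(** The equations say that the product of (1, w) and (x, w y) is zero. Put
    A = bar y - x. Eliminating between them shows that A * sig A is the product of the
    nonsquare B w sig w and an element l fixed by bar, that is, of a nonsquare and a
    square unless l = 0. As A * sig A is a square, A = 0. *)
Lemma normalized_no_zero_divisors B c w x y : admissible B c -> w != 0 ->
  sig x + x + B * w * sig w * (sig y + y) = 0 ->
  w * (rho x + y) + c * rho w * (x + rho y) = 0 -> x = 0 /\ y = 0.
Proof.
move=> [chiB cB_nz cB_fix] w_nz e1 e2.
have B_nz := chi_neq0 chiB.
have sw_nz : sig w != 0 by rewrite fmorph_eq0.
have bw_nz : bar w != 0 by rewrite fmorph_eq0.
have bB_nz : bar B != 0 by rewrite fmorph_eq0.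
have bb := bar_bar tw.
have chiBw : chi (B * w * sig w) = -1.
  by rewrite !chiM chi_rmorph -mulrA chi_sqr // mulr1.
pose T := sig y + y; pose Q := x + rho y.
pose l := T * bar T - (c * B) / (B * bar B * w * bar w) * (Q * bar Q).
have l_fix : bar l = l.
  rewrite /l rmorphB !rmorphM fmorphV !rmorphM !bb -[bar c * bar B]rmorphM cB_fix.
  by congr (_ - _ / _ * _); ring.
have key : (bar y - x) * sig (bar y - x) = B * w * sig w * l.
  have S_eq : sig x + x = - (B * w * sig w * T) by apply/eqP; rewrite -addr_eq0 e1.
  have P_eq : bar (rho x + y) = - (bar c * sig w / bar w * bar Q).
    apply/eqP; rewrite -addr_eq0; apply/eqP.
    have e2' : bar w * bar (rho x + y) + bar c * sig w * bar Q = 0.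
      by rewrite -(rmorph0 bar) -e2 [RHS]rmorphD !rmorphM bb.
    by apply: (mulfI bw_nz); rewrite mulr0 -e2'; field.
  have -> : (bar y - x) * sig (bar y - x) = Q * bar (rho x + y) - (sig x + x) * bar T.
    rewrite /Q /T !rmorphB !rmorphD !bb (sig_bar tw); ring.
  have bcE : bar c = c * B / bar B by apply: (mulIf bB_nz); rewrite -rmorphM cB_fix; field.
  by rewrite P_eq S_eq bcE /l; field; rewrite ?B_nz ?bB_nz ?w_nz ?bw_nz.
have A0 : bar y - x = 0.
  apply/eqP; apply: contraTT isT => A_nz.
  have l_nz : l != 0.
    apply: contraNneq A_nz => l0; move/eqP: key; rewrite l0 mulr0 mulf_eq0 fmorph_eq0.
    by rewrite orbb => /eqP->.
  have : chi ((bar y - x) * sig (bar y - x)) = 1 by rewrite chiM chi_rmorph chi_sqr.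
  rewrite key chiM chiBw (chi_bar_fix l_nz l_fix) mulr1 => /eqP.
  by rewrite eq_sym (negPf one_neqN1).
(* Now the first equation makes the norm 1 element bar T / T a nonsquare. *)
have def_x : x = bar y by apply/eqP; rewrite eq_sym -subr_eq0 A0.
have [T0 | T_nz] := eqVneq T 0.
  have y0 : y = 0 by apply: sig_opp; apply/eqP; rewrite -addr_eq0 -/T T0.
  by rewrite def_x y0 rmorph0.
have bT_nz : bar T != 0 by rewrite fmorph_eq0.
have bT : bar T = - (B * w * sig w) * T.
  apply/eqP; rewrite mulNr -addr_eq0 -e1 -/T; apply/eqP.
  by rewrite def_x /T rmorphD (sig_bar tw).
have : chi (bar T / T) = 1.
  by apply: (quad_char_norm1 tw); rewrite fmorph_div bb; field; rewrite T_nz bT_nz.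
rewrite bT mulfK // chiN chiBw => /eqP.
by rewrite eq_sym (negPf one_neqN1).
Qed.

(** When u and v are nonzero, dividing x by u and y by v reduces to the normalized case
    with w = v / u. *)
Lemma semifield_mul_eq0 B c X Y : admissible B c ->
  semifield_mul sig bar B c X Y = 0 -> X = 0 \/ Y = 0.
Proof.
move=> adm; have chiB : chi B = -1 by case: adm.
have B_nz := chi_neq0 chiB; have chi_c := admissible_chi adm.
case: X Y => [x y] [u v] [/= e1 e2].
have s_nz z : z != 0 -> sig z != 0 by rewrite fmorph_eq0.
have r_nz z : z != 0 -> rho z != 0 by rewrite !fmorph_eq0.
have skew z z' : z' != 0 -> rho z * z' + c * (z * rho z') = 0 -> z = 0.
  move=> z'_nz e; suff /(rho_skew_eq0 chi_c)/eqP : rho (z / z') = - (c * (z / z')).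
    by rewrite mulf_eq0 invr_eq0 (negPf z'_nz) orbF => /eqP.
  rewrite !fmorph_div mulrA; apply/eqP; rewrite -addr_eq0 addf_div ?r_nz //.
  by rewrite -(mulrA c z) e mul0r.
have [u0 | u_nz] := eqVneq u 0.
  have [v0 | v_nz] := eqVneq v 0; first by right; rewrite u0 v0.
  left; move: e1 e2; rewrite u0 !rmorph0 !(mulr0, mul0r, add0r, addr0).
  move/eqP; rewrite mulf_eq0 (negPf B_nz) => /eqP/(sig_add_eq0 v_nz) ->.
  by move/(skew _ _ v_nz) ->.
have [v0 | v_nz] := eqVneq v 0.
  left; move: e1 e2; rewrite v0 !rmorph0 !(mulr0, mul0r, add0r, addr0).
  move/(sig_add_eq0 u_nz) -> => e2; congr (_, _).
  have [// | y_nz] := eqVneq y 0.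
  by move/eqP: u_nz; case; apply: (skew _ y y_nz).
left.
have [] := @normalized_no_zero_divisors B c (v / u) (x / u) (y / v) adm.
- by rewrite mulf_neq0 ?invr_eq0.
- apply: (mulIf (mulf_neq0 u_nz (s_nz _ u_nz))); rewrite mul0r -e1 !fmorph_div.
  by field; rewrite ?u_nz ?v_nz ?s_nz.
- apply: (mulIf (mulf_neq0 u_nz (r_nz _ u_nz))); rewrite mul0r -e2 !fmorph_div.
  by field; rewrite ?u_nz ?v_nz ?r_nz.
move/eqP; rewrite mulf_eq0 invr_eq0 (negPf u_nz) orbF => /eqP ->.
by move/eqP; rewrite mulf_eq0 invr_eq0 (negPf v_nz) orbF => /eqP ->.
Qed.

(** * Linear isotopisms *)

Lemma twist_independent (al be : K) :
  (forall x, al * rho x = be * x) -> al = 0 /\ be = 0.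
Proof.
move=> e; have [x0 sx0 bx0] := sig_fix_not_bar tw.
have eq_al : al = be by have := e 1; rewrite !rmorph1 !mulr1.
suff : be = 0 by rewrite eq_al.
apply/eqP; have /eqP := e x0; rewrite sx0 eq_al -subr_eq0 -mulrBr mulf_eq0.
by rewrite subr_eq0 (negPf bx0) orbF.
Qed.

Lemma twist_independent2 (al be : K) :
  (forall x u, al * (rho x * u) + be * (x * rho u) = 0) -> al = 0 /\ be = 0.
Proof.
move=> e; have [|-> /eqP] := @twist_independent al (- be).
  move=> x; apply/eqP; rewrite mulNr -addr_eq0; apply/eqP.
  by have := e x 1; rewrite !rmorph1 !mulr1.
by rewrite oppr_eq0 => /eqP.
Qed.

(** If sig fixes x0, the argument of n takes the same value at (x0 x, 1) and at (x, x0),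
    whereas bar x0 <> x0 separates the right-hand sides. *)
Lemma sig_form_no_rho (n : K -> K) (al be : K) :
  (forall x u, n (sig x * u + x * sig u) = al * (rho x * u) + be * (x * rho u)) ->
  al = 0 /\ be = 0.
Proof.
move=> n_eq; have [x0 sx0 bx0] := sig_fix_not_bar tw.
apply: twist_independent => x; apply/eqP; rewrite -subr_eq0.
have : al * (rho (x0 * x) * 1) + be * (x0 * x * rho 1) =
       al * (rho x * x0) + be * (x * rho x0).
  by rewrite -!n_eq rmorphM rmorph1 sx0; congr n; ring.
rewrite !rmorphM !rmorph1 sx0 => /eqP; rewrite -subr_eq0 => e.
have : (bar x0 - x0) * (al * rho x - be * x) == 0 by rewrite -(eqP e); apply/eqP; ring.
by rewrite mulf_eq0 (subr_eq0 (bar x0)) (negPf bx0).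
Qed.

(** If all four were nonzero, om = (l m') / (l' m) would satisfy rho om = 1 / om. Then
    sig^2 fixes om, so sig fixes it and om has norm 1; thus om is a square. But
    rho l * m' = - c (m rho l') and c is a nonsquare, so that om is a nonsquare. *)
Lemma rho_pairing_degenerate (c l l' m m' : K) : chi c = -1 ->
    (l != 0) || (l' != 0) -> (m != 0) || (m' != 0) ->
    rho l * m' + c * (m * rho l') = 0 -> rho m * l' + c * (l * rho m') = 0 ->
  l = 0 /\ m = 0 \/ l' = 0 /\ m' = 0.
Proof.
move=> chi_c L_nz M_nz e1 e2; have c_nz := chi_neq0 chi_c.
have r_nz z : z != 0 -> rho z != 0 by rewrite !fmorph_eq0.
have [l0 | l_nz] := eqVneq l 0.
  rewrite l0 eqxx /= in L_nz; left; split=> //; move/eqP: e1.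
  by rewrite l0 !rmorph0 mul0r add0r !mulf_eq0 (negPf c_nz) !fmorph_eq0 (negPf L_nz) orbF => /eqP.
have [l0 | l'_nz] := eqVneq l' 0.
  right; split=> //; move/eqP: e1.
  by rewrite l0 !rmorph0 !mulr0 addr0 !mulf_eq0 !fmorph_eq0 (negPf l_nz) => /eqP.
have m_nz : m != 0.
  apply: contraTneq M_nz => m0; rewrite m0 eqxx /= negbK.
  by move/eqP: e1; rewrite m0 mul0r mulr0 addr0 mulf_eq0 !fmorph_eq0 (negPf l_nz).
have m'_nz : m' != 0.
  apply: contraTneq M_nz => m0; rewrite m0 eqxx orbF negbK.
  by move/eqP: e1; rewrite m0 mulr0 add0r !mulf_eq0 (negPf c_nz) !fmorph_eq0 (negPf l'_nz) orbF.
pose om := (l * m') / (l' * m).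
have om_nz : om != 0 by rewrite !mulf_neq0 // invr_eq0 mulf_neq0.
have e1' : rho l * m' = - (c * (m * rho l')) by apply/eqP; rewrite -addr_eq0 e1.
have e2' : rho m * l' = - (c * (l * rho m')) by apply/eqP; rewrite -addr_eq0 e2.
have om_rho : rho om * om = 1.
  rewrite /om !fmorph_div !rmorphM mulf_div.
  rewrite (_ : _ * _ * (l * m') = (rho l * m') * (l * rho m')); last by ring.
  have -> : rho l' * rho m * (l' * m) = (rho m * l') * (m * rho l') by ring.
  rewrite e1' e2'; field; rewrite ?c_nz ?l_nz ?m_nz ?r_nz //.
  by rewrite oppr_eq0 !mulf_neq0 ?r_nz.
have rho_om : rho om = om^-1 by apply: (mulIf om_nz); rewrite om_rho mulVf.
have sig_om : sig om = om.
  by apply: (sig2_fix tw); rewrite -rho_rho rho_om !fmorphV rho_om invrK.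
have : chi om = 1 by apply: (quad_char_norm1 tw); rewrite -{2}sig_om mulrC.
have : chi (rho l * m') = - chi (m * rho l') by rewrite e1' chiN chiM chi_c mulN1r.
rewrite !chiM !chi_rmorph.
have chiVE z : z != 0 -> chi z^-1 = chi z.
  by move=> z_nz; rewrite chiV; case: (chi_cases z_nz) => ->; rewrite ?invrN ?invr1.
rewrite chiVE ?mulf_neq0 // !chiM => ->.
rewrite mulNr mulrACA [chi l' * chi m]mulrC mulrACA !chi_sqr // mulr1 => /eqP.
by rewrite eq_sym (negPf one_neqN1).
Qed.

Lemma semifield_mulC B c X Y : X *[B, c] Y = Y *[B, c] X.
Proof. by rewrite /semifield_mul; congr (_, _); ring. Qed.

Lemma semifield_mulDl B c X Y Z : (X + Y) *[B, c] Z = X *[B, c] Z + Y *[B, c] Z.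
Proof. by rewrite /semifield_mul /= !rmorphD; congr (_, _) => /=; ring. Qed.

(* Products of the two coordinate axes: l stands for the first one, r for the second. *)
Lemma mul_ll B c x u : (x, 0) *[B, c] (u, 0) = (sig x * u + x * sig u, 0).
Proof. by rewrite /semifield_mul /= !rmorph0 !(mulr0, mul0r, addr0). Qed.

Lemma mul_rr B c y v : (0, y) *[B, c] (0, v) = (B * (sig y * v + y * sig v), 0).
Proof. by rewrite /semifield_mul /= !rmorph0 !(mulr0, mul0r, add0r). Qed.

Lemma mul_lr B c x v : (x, 0) *[B, c] (0, v) = (0, rho x * v + c * (x * rho v)).
Proof. by rewrite /semifield_mul /= !rmorph0 !(mulr0, mul0r, addr0). Qed.

Lemma mul_rl B c y u : (0, y) *[B, c] (u, 0) = (0, rho u * y + c * (u * rho y)).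
Proof. by rewrite /semifield_mul /= !rmorph0 !(mulr0, mul0r, add0r, addr0). Qed.

(** The left-hand side is symmetric in x and u, and sig is not the identity; this
    forces m / l to be fixed by sig. *)
Lemma sig_form_scale (n : K -> K) (b l m : K) : b != 0 -> l != 0 ->
    (forall x u, n (sig x * u + x * sig u) =
      b * (sig (l * x) * (m * u) + (l * x) * sig (m * u))) ->
  sig (m / l) = m / l /\
  forall x, n (sig x + x) = b * (m / l) * (sig l * l) * (sig x + x).
Proof.
move=> b_nz l_nz n_eq; have [x0 sx0] := sig_not_id tw.
have sl_nz : sig l != 0 by rewrite fmorph_eq0.
have key : sig l * m = l * sig m.
  have : b * (sig (l * x0) * (m * 1) + (l * x0) * sig (m * 1)) =
         b * (sig (l * 1) * (m * x0) + (l * 1) * sig (m * x0)).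
    by rewrite -!n_eq; congr n; rewrite rmorph1; ring.
  move/(mulfI b_nz)/eqP; rewrite !rmorphM !rmorph1 -subr_eq0 => e.
  have : (sig x0 - x0) * (sig l * m - l * sig m) == 0.
    by rewrite -(eqP e); apply/eqP; ring.
  by rewrite mulf_eq0 (subr_eq0 (sig x0)) (negPf sx0) /= subr_eq0 => /eqP.
split=> [|x].
  by rewrite fmorph_div; apply/eqP; rewrite eqr_div // mulrC -key mulrC.
have := n_eq x 1; rewrite rmorph1 !mulr1 => ->; rewrite !rmorphM -[l * x * _]mulrAC -key.
by field.
Qed.

Lemma sig_add_onto z : exists x, sig x + x = z.
Proof.
have inj : injective (fun x => sig x + x).
  move=> x x' /eqP; rewrite -subr_eq0 opprD addrACA -rmorphB => e.
  apply/eqP; rewrite -subr_eq0; apply/eqP; apply: sig_opp.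
  by apply/eqP; rewrite -addr_eq0.
by exists (invF inj z); rewrite (f_invF inj).
Qed.

Section Diagonal.
Variables (B1 c1 B2 c2 l1 l4 m1 m4 : K) (N : K * K -> K * K).
Hypothesis N_add : forall X Y, N (X + Y) = N X + N Y.
Hypotheses (adm1 : admissible B1 c1) (adm2 : admissible B2 c2).
Hypotheses (l1_nz : l1 != 0) (l4_nz : l4 != 0) (m1_nz : m1 != 0).
Hypothesis N_mul : forall X Y, N (X *[B1, c1] Y) =
  (l1 * X.1, l4 * X.2) *[B2, c2] (m1 * Y.1, m4 * Y.2).

(** The products of an axis with itself show that k = m1 / l1 and k' = m4 / l4 are fixed
    by sig and give the fourth equation, with k' for bar k; the two products of distinct
    axes, which give the same value of N, show that k' = bar k. It remains to compare c1
    and c2. Comparing N at (x e, 1) and (x, rho e) with sig (sig e) <> e isolates the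
    second term, and shows that N multiplies the second axis by c2 l1 rho m4 / c1; the
    first term shows that it multiplies it by rho l1 m4. *)
Lemma diagonal_isotopism : exists k,
  [/\ k != 0 /\ sig k = k, m1 = k * l1, m4 = bar k * l4,
      B1 * k * (sig l1 * l1) = B2 * bar k * (sig l4 * l4) &
      c2 * B2 * sig (l4 * bar l4) = c1 * B1 * sig (l1 * bar l1)].
Proof.
have B1_nz : B1 != 0 by case: adm1 => /chi_neq0.
have B2_nz : B2 != 0 by case: adm2 => /chi_neq0.
have c1_nz := chi_neq0 (admissible_chi adm1).
have c2_nz := chi_neq0 (admissible_chi adm2).
have r_nz z : z != 0 -> rho z != 0 by rewrite !fmorph_eq0.
have Nm x y u v : N ((x, y) *[B1, c1] (u, v)) =
    (l1 * x, l4 * y) *[B2, c2] (m1 * u, m4 * v) := N_mul (x, y) (u, v).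
have [k_fix n1_eq] : sig (m1 / l1) = m1 / l1 /\
    forall x, (N (sig x + x, 0)).1 = 1 * (m1 / l1) * (sig l1 * l1) * (sig x + x).
  apply: (@sig_form_scale (fun z => (N (z, 0)).1)); rewrite ?oner_neq0 // => x u.
  by rewrite -(mul_ll B1 c1) Nm !mulr0 mul_ll /= mul1r.
have [k'_fix n4_eq] : sig (m4 / l4) = m4 / l4 /\
    forall x, (N (B1 * (sig x + x), 0)).1 = B2 * (m4 / l4) * (sig l4 * l4) * (sig x + x).
  apply: (@sig_form_scale (fun z => (N (B1 * z, 0)).1)); rewrite ?oner_neq0 // => x u.
  by rewrite -(mul_rr B1 c1) Nm !mulr0 mul_rr.
have [m1E m4E] : m1 = m1 / l1 * l1 /\ m4 = m4 / l4 * l4 by rewrite !divfK.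
move: k_fix n1_eq k'_fix n4_eq; have : m1 / l1 != 0 by rewrite mulf_neq0 ?invr_eq0.
move: (m1 / l1) (m4 / l4) m1E m4E => k k' m1E m4E k_nz k_fix n1_eq k'_fix n4_eq.
have first_eq : B1 * k * (sig l1 * l1) = B2 * k' * (sig l4 * l4).
  have [x x_eq] := sig_add_onto (B1 * (sig 1 + 1)).
  have := n1_eq x; rewrite x_eq n4_eq rmorph1 => e; apply: (mulIf (two_neq0 tw)).
  by rewrite e; ring.
have nlr x v : N (0, rho x * v + c1 * (x * rho v)) =
    (0, rho (l1 * x) * (m4 * v) + c2 * (l1 * x * rho (m4 * v))).
  by rewrite -(mul_lr B1) Nm !mulr0 mul_lr.
have nrl x v : N (0, rho x * v + c1 * (x * rho v)) =
    (0, rho (m1 * x) * (l4 * v) + c2 * (m1 * x * rho (l4 * v))).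
  by rewrite -(mul_rl B1) Nm !mulr0 mul_rl.
have [eq1 _] : rho l1 * m4 - rho m1 * l4 = 0 /\ c2 * (l1 * rho m4 - m1 * rho l4) = 0.
  apply: twist_independent2 => x u.
  have /(congr1 snd)/eqP := etrans (esym (nlr x u)) (nrl x u).
  by rewrite /= -subr_eq0 => /eqP <-; rewrite !rmorphM; ring.
have k'E : k' = bar k.
  have /eqP : rho l1 * l4 * (k' - bar k) = 0.
    by rewrite -eq1 {1}m4E m1E !rmorphM k_fix; ring.
  by rewrite !mulf_eq0 !fmorph_eq0 (negPf l1_nz) (negPf l4_nz) subr_eq0 => /eqP.
have n_c1 z : (N (0, c1 * z)).2 = c2 * (l1 * rho m4) * z.
  have [e e_nfix] := sig_not_id tw.
  have d_nz : e - sig (sig e) != 0.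
    by apply: contra e_nfix; rewrite subr_eq0 => /eqP/esym/(sig2_fix tw)/eqP.
  have [x {z}<-] : exists x, x * (e - sig (sig e)) = z.
    by exists (z / (e - sig (sig e))); rewrite divfK.
  have := nlr x (rho e); have := nlr (x * e) 1.
  rewrite !rmorphM !rmorph1 rho_rho !mulr1.
  have -> : (0, rho x * rho e + c1 * (x * e)) =
    (0, rho x * rho e + c1 * (x * sig (sig e))) + (0, c1 * (x * (e - sig (sig e)))) :> K * K.
    by congr (_, _) => /=; [rewrite addr0 | ring].
  rewrite N_add => e1 e2; move: e1; rewrite e2 => /(congr1 snd) /=.
  move/(canRL (addKr _)) ->; ring.
have n_rho x : (N (0, rho x)).2 = rho l1 * m4 * rho x.
  have /(congr1 snd) /= := nlr x 1; rewrite !rmorphM !rmorph1 !mulr1.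
  have -> : (0, rho x + c1 * x) = (0, rho x) + (0, c1 * x) :> K * K.
    by congr (_, _) => /=; rewrite addr0.
  rewrite N_add /= n_c1 => /(canRL (addrK _)) ->; ring.
have second_eq : c2 * (l1 * rho m4) = rho l1 * m4 * c1.
  have rho_inj : injective (fun x => rho x) by move=> x y /fmorph_inj/fmorph_inj.
  by have := n_rho (invF rho_inj c1); rewrite (f_invF rho_inj) => <-; rewrite -[c1]mulr1 n_c1 mulr1.
rewrite k'E in m4E first_eq *.
exists k; split=> //.
have rbk : rho (bar k) = k by rewrite (sig_bar tw) (bar_bar tw).
have bk_nz : bar k != 0 by rewrite fmorph_eq0.
move: second_eq; rewrite m4E !rmorphM rbk => second_eq.
have sb x : sig (bar x) = rho x by rewrite (sig_bar tw).
rewrite !sb; apply: (mulIf (mulf_neq0 k_nz l1_nz)); apply: (mulIf (mulf_neq0 bk_nz l4_nz)).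
transitivity ((c2 * (l1 * (k * rho l4))) * (B2 * bar k * (sig l4 * l4))); first by ring.
by rewrite second_eq -first_eq; ring.
Qed.

End Diagonal.

(** Exchanging the coordinates reduces antidiagonal isotopisms to diagonal ones. *)
Lemma semifield_mul_swap B c x y u v : B != 0 -> c != 0 ->
  (y, x) *[B, c] (v, u) =
    (B * ((x, y) *[B^-1, c^-1] (u, v)).1, c * ((x, y) *[B^-1, c^-1] (u, v)).2).
Proof. by move=> B_nz c_nz; rewrite /semifield_mul /=; congr (_, _); field. Qed.

Lemma admissibleV B c : admissible B c -> admissible B^-1 c^-1.
Proof.
case=> chiB cB_nz cB_fix; split; first by rewrite chiV chiB invrN invr1.
  by rewrite -invfM mulrC invr_eq0 mulrC.
by rewrite -invfM mulrC fmorphV mulrC cB_fix.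
Qed.

(** The linear map that sends the standard basis to a and b. *)
Definition lin2 (a b X : K * K) : K * K :=
  (a.1 * X.1 + b.1 * X.2, a.2 * X.1 + b.2 * X.2).

Section Linear.
Variables (B1 c1 B2 c2 : K) (a b a' b' : K * K) (N : K * K -> K * K).
Hypothesis (adm1 : admissible B1 c1) (adm2 : admissible B2 c2).
Hypothesis ab_inj : forall X, lin2 a b X = 0 -> X = 0.
Hypothesis ab'_inj : forall X, lin2 a' b' X = 0 -> X = 0.
Hypothesis N_mul : forall X Y, N (X *[B1, c1] Y) = lin2 a b X *[B2, c2] lin2 a' b' Y.

Let col_neq0 (e f : K * K) : (forall X, lin2 e f X = 0 -> X = 0) ->
  ((e.1 != 0) || (e.2 != 0)) && ((f.1 != 0) || (f.2 != 0)).
Proof.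
move=> inj; rewrite -!negb_and; apply/andP; split; apply/negP => /andP[/eqP e1 /eqP e2].
  have /inj/(congr1 fst)/eqP : lin2 e f (1, 0) = 0.
    by rewrite /lin2 /= e1 e2 !mul0r !mulr0 addr0.
  by rewrite oner_eq0.
have /inj/(congr1 snd)/eqP : lin2 e f (0, 1) = 0.
  by rewrite /lin2 /= e1 e2 !mul0r !mulr0 addr0.
by rewrite oner_eq0.
Qed.

Let det_neq0 (e f : K * K) : (forall X, lin2 e f X = 0 -> X = 0) ->
  ~ (e.1 = 0 /\ f.1 = 0) /\ ~ (e.2 = 0 /\ f.2 = 0).
Proof.
move=> inj; have /andP[_ f_nz] := col_neq0 inj.
split=> -[e0 f0]; move: f_nz; rewrite f0 eqxx ?orbF /= => /eqP; case.
  by have /inj/(congr1 fst) : lin2 e f (f.2, - e.2) = 0;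
    first by rewrite /lin2 /= e0 f0; congr (_, _) => /=; ring.
by have /inj/(congr1 fst) : lin2 e f (f.1, - e.1) = 0;
  first by rewrite /lin2 /= e0 f0; congr (_, _) => /=; ring.
Qed.

(* A product of an axis with itself has second coordinate 0, and the forms in sig that
   give its first coordinate cannot yield any form in rho. *)
Let column_degenerate (e e' : K * K) (n : K -> K) :
    (e.1 != 0) || (e.2 != 0) -> (e'.1 != 0) || (e'.2 != 0) ->
    (forall x u, n (sig x * u + x * sig u) =
      ((e.1 * x, e.2 * x) *[B2, c2] (e'.1 * u, e'.2 * u)).2) ->
  e.1 = 0 /\ e'.1 = 0 \/ e.2 = 0 /\ e'.2 = 0.
Proof.
move=> e_nz e'_nz n_eq.
have [e1 e2] : rho e.1 * e'.2 + c2 * (e'.1 * rho e.2) = 0 /\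
               rho e'.1 * e.2 + c2 * (e.1 * rho e'.2) = 0.
  apply: (@sig_form_no_rho n) => x u; rewrite n_eq /semifield_mul /= !rmorphM; ring.
exact: (rho_pairing_degenerate (admissible_chi adm2)) e1 e2.
Qed.

Lemma linear_shape :
  [/\ a.2 = 0, b.1 = 0, a'.2 = 0 & b'.1 = 0] \/ [/\ a.1 = 0, b.2 = 0, a'.1 = 0 & b'.2 = 0].
Proof.
have /andP[a_nz b_nz] := col_neq0 ab_inj; have /andP[a'_nz b'_nz] := col_neq0 ab'_inj.
have [ab1 ab2] := det_neq0 ab_inj.
have a_cases : a.1 = 0 /\ a'.1 = 0 \/ a.2 = 0 /\ a'.2 = 0.
  apply: (@column_degenerate a a' (fun z => (N (z, 0)).2)) => // x u /=.
  by rewrite -(mul_ll B1 c1) N_mul /lin2 /= !mulr0 !addr0.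
have b_cases : b.1 = 0 /\ b'.1 = 0 \/ b.2 = 0 /\ b'.2 = 0.
  apply: (@column_degenerate b b' (fun z => (N (B1 * z, 0)).2)) => // x u /=.
  by rewrite -(mul_rr B1 c1) N_mul /lin2 /= !mulr0 !add0r.
case: a_cases b_cases => -[a0 a'0] [[b0 b'0]|[b0 b'0]].
- by case: ab1.
- by right.
- by left.
- by case: ab2.
Qed.

(** Take for y the norm of the ratio of the two nonzero entries of the first matrix.
    The unknown k of [diagonal_isotopism] disappears because k and bar k have the same
    norm. The two cases are those of a diagonal and of an antidiagonal isotopism. *)
Lemma linear_isotopism_parameters : (forall X Y, N (X + Y) = N X + N Y) ->
  exists2 y, bar y = y &
    B1 * bar B1 * (y * sig y) = B2 * bar B2 /\ c2 * B2 = c1 * B1 * sig y \/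
    y * sig y = B1 * bar B1 * (B2 * bar B2) /\ c2 * B2 = (c1 * B1)^-1 * sig y.
Proof.
move=> N_add.
have [chiB1 cB1 _] := adm1; have [chiB2 cB2 _] := adm2.
have B1_nz := chi_neq0 chiB1; have B2_nz := chi_neq0 chiB2.
have c1_nz := chi_neq0 (admissible_chi adm1); have c2_nz := chi_neq0 (admissible_chi adm2).
have bb := bar_bar tw; have sb x : sig (bar x) = rho x by rewrite (sig_bar tw).
have bnz z : z != 0 -> bar z != 0 by rewrite fmorph_eq0.
have snz z : z != 0 -> sig z != 0 by rewrite fmorph_eq0.
have col_eq (e f : K * K) : (forall X, lin2 e f X = 0 -> X = 0) ->
    (e.2 = 0 -> f.1 = 0 -> e.1 != 0 /\ f.2 != 0) /\
    (e.1 = 0 -> f.2 = 0 -> e.2 != 0 /\ f.1 != 0).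
  move/col_neq0/andP => [e_nz f_nz]; split=> e0 f0; move: e_nz f_nz; rewrite e0 f0 eqxx ?orbF //.
have norm_eq (B B' k l l' : K) : B != 0 -> B' != 0 -> k != 0 -> l != 0 -> l' != 0 ->
    B * k * (sig l * l) = B' * bar k * (sig l' * l') ->
    B * bar B * ((l / l') * bar (l / l') * sig ((l / l') * bar (l / l'))) = B' * bar B'.
  move=> B_nz B'_nz k_nz l_nz l'_nz e.
  have := congr1 (fun z => z * bar z) e; rewrite /= !rmorphM !bb => e'.
  apply: (mulIf (mulf_neq0 k_nz (bnz _ k_nz))).
  rewrite !fmorphV !sb.
  have sl'_nz := mulf_neq0 l'_nz (snz _ l'_nz).
  apply: (mulIf (mulf_neq0 sl'_nz (bnz _ sl'_nz))).
  rewrite rmorphM.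
  transitivity (B * k * (sig l * l) * (bar B * bar k * (rho l * bar l))).
    by field; rewrite ?l'_nz ?bnz ?snz.
  by rewrite e'; ring.
have [aE bE] := col_eq _ _ ab_inj; have [a'E b'E] := col_eq _ _ ab'_inj.
have quot_fix (l l' : K) : bar (l / l' * bar (l / l')) = l / l' * bar (l / l').
  by rewrite rmorphM bb mulrC.
have [[a2 b1 a'2 b'1]|[a1 b2 a'1 b'2]] := linear_shape.
  have [a1_nz b2_nz] := aE a2 b1; have [a'1_nz _] := a'E a'2 b'1.
  have [|k [[k_nz _] _ _ e1 e2]] :=
      diagonal_isotopism (m4 := b'.2) N_add adm1 adm2 a1_nz b2_nz a'1_nz.
    by move=> X Y; rewrite N_mul /lin2 a2 b1 a'2 b'1 !mul0r !add0r !addr0.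
  exists (a.1 / b.2 * bar (a.1 / b.2)) => //; left; split; first exact: norm_eq e1.
  apply: (mulIf (snz _ (mulf_neq0 b2_nz (bnz _ b2_nz)))); rewrite e2 -[RHS]mulrA -rmorphM.
  congr (_ * sig _); rewrite fmorph_div; field; rewrite ?b2_nz ?bnz //.
have [a2_nz b1_nz] := bE a1 b2; have [_ b'1_nz] := b'E a'1 b'2.
pose N' (X : K * K) := N (B1 * X.1, c1 * X.2).
have N'_add X Y : N' (X + Y) = N' X + N' Y by rewrite -N_add /N' /= !mulrDr.
have [|k [[k_nz _] _ _ e1 e2]] :=
    diagonal_isotopism (m4 := a'.2) N'_add (admissibleV adm1) adm2 b1_nz a2_nz b'1_nz.
  move=> [x y] [u v] /=.
  rewrite /N' -semifield_mul_swap // N_mul /lin2 /= a1 b2 a'1 b'2.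
  by rewrite !mul0r !add0r !addr0.
exists (b.1 / a.2 * bar (b.1 / a.2)) => //; right; split.
  rewrite -(norm_eq _ _ _ _ _ (invr_neq0 B1_nz) B2_nz k_nz b1_nz a2_nz e1).
  by rewrite fmorphV -invfM mulrA divff ?mul1r // mulf_neq0 ?bnz.
apply: (mulIf (snz _ (mulf_neq0 a2_nz (bnz _ a2_nz)))); rewrite e2 -[RHS]mulrA -rmorphM invfM.
congr (_ * sig _); rewrite fmorph_div; field; rewrite ?a2_nz ?bnz //.
Qed.
End Linear.


Lemma sig_norm1 z : z * sig z = 1 -> z ^+ 2 = 1.
Proof.
move=> zs; have z_nz : z != 0 by apply: contra_eq_neq zs => ->; rewrite mul0r eq_sym oner_eq0.
have sz : sig z = z^-1 by apply: (mulfI z_nz); rewrite zs divff.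
by rewrite expr2 -{2}(@sig2_fix _ _ _ tw z) // !sz ?fmorphV ?sz ?invrK.
Qed.

(** This is what determines y in [linear_isotopism_parameters] up to sign. *)
Lemma sig_norm_inj y z : z != 0 -> y * sig y = z * sig z -> y = z \/ y = - z.
Proof.
move=> z_nz e; have sz_nz : sig z != 0 by rewrite fmorph_eq0.
have : (y / z) ^+ 2 = 1.
  by apply: sig_norm1; rewrite fmorph_div mulf_div e divff // mulf_neq0.
move/eqP; rewrite sqrf_eq1 => /orP[] /eqP /(canRL (divfK z_nz)) ->.
  by left; rewrite mul1r.
by right; rewrite mulN1r.
Qed.

(** For an autotopism the ratio e of l1 and l4 satisfies k * (e sig e) = bar k with k fixed
    by sig. Raising to the power r kills k and bar k, and leaves a square root of 1. *)
Lemma diagonal_autotopism_power (B c l1 l4 m1 m4 : K) (N : K * K -> K * K) (r : nat) :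
    (forall X Y, N (X + Y) = N X + N Y) -> admissible B c ->
    l1 != 0 -> l4 != 0 -> m1 != 0 ->
    (forall X Y, N (X *[B, c] Y) = (l1 * X.1, l4 * X.2) *[B, c] (m1 * Y.1, m4 * Y.2)) ->
    (forall k, k != 0 -> sig k = k -> k ^+ r = 1) ->
  [/\ l4 ^+ (r * 2) = l1 ^+ (r * 2), m1 ^+ (r * 2) = l1 ^+ (r * 2)
    & m4 ^+ (r * 2) = l1 ^+ (r * 2)].
Proof.
move=> N_add adm l1_nz l4_nz m1_nz N_mul r_kills.
have [k [[k_nz k_fix] -> -> e _]] := diagonal_isotopism N_add adm adm l1_nz l4_nz m1_nz N_mul.
have B_nz : B != 0 by case: adm => /chi_neq0.
have kr : k ^+ r = 1 by apply: r_kills.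
have bkr : bar k ^+ r = 1 by rewrite -rmorphXn kr rmorph1.
have l4E : l4 ^+ (r * 2) = l1 ^+ (r * 2).
  rewrite !exprM; apply/eqP; rewrite eq_sym -subr_eq0.
  have l4r_nz : l4 ^+ r != 0 by rewrite expf_neq0.
  have : (l1 ^+ r / l4 ^+ r) ^+ 2 = 1.
    have e' : l1 ^+ r * sig (l1 ^+ r) = l4 ^+ r * sig (l4 ^+ r).
      have : k * (sig l1 * l1) = bar k * (sig l4 * l4).
        by apply: (mulfI B_nz); rewrite !(mulrA B).
      move/(congr1 (fun z => z ^+ r)); rewrite !exprMn kr bkr !mul1r !rmorphXn.
      by rewrite mulrC => ->; rewrite mulrC.
    by apply: sig_norm1; rewrite fmorph_div mulf_div e' divff // mulf_neq0 ?fmorph_eq0.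
  rewrite expr_div_n => /(canRL (divfK _)) ->; first by rewrite mul1r subrr.
  by rewrite expf_neq0.
by rewrite !(exprMn, exprM) kr bkr !expr1n !mul1r -!exprM.
Qed.

End TwistedMultiplication.

(** * Isotopism groups and scalars *)

HB.instance Definition _ (U V : finZmodType) := Finite.on (U * V)%type.

Definition is_additive (U V : finZmodType) (L : U -> V) : bool :=
  [forall x, forall y, L (x + y) == L x + L y].

Lemma is_additiveP (U V : finZmodType) (L : U -> V) :
  reflect (forall x y, L (x + y) = L x + L y) (is_additive L).
Proof.
apply: (iffP forallP) => [H x y | H x]; first by have /forallP/(_ y)/eqP := H x.
by apply/forallP => y; rewrite H.
Qed.

Lemma is_additive_perm1 (V : finZmodType) : is_additive (1%g : {perm V}).
Proof. by apply/is_additiveP => x y; rewrite !perm1. Qed.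

Lemma is_additive_permM (V : finZmodType) (L M : {perm V}) :
  is_additive L -> is_additive M -> is_additive (L * M)%g.
Proof.
move=> /is_additiveP L_add /is_additiveP M_add.
by apply/is_additiveP => x y; rewrite !permM L_add M_add.
Qed.

Lemma is_additive_permV (V : finZmodType) (L : {perm V}) :
  is_additive L -> is_additive (L^-1)%g.
Proof.
move=> /is_additiveP L_add; apply/is_additiveP => x y.
by apply: (@perm_inj _ L); rewrite L_add !permKV.
Qed.

Section PairGroup.
Variable V : finZmodType.
Implicit Types g h : ({perm V} * {perm V})%type.
Lemma pair_mulgE g h : ((g * h)%g.1 = (g.1 * h.1)%g) * ((g * h)%g.2 = (g.2 * h.2)%g).
Proof. by []. Qed.
Lemma pair_invgE g : ((g^-1)%g.1 = (g.1^-1)%g) * ((g^-1)%g.2 = (g.2^-1)%g).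
Proof. by []. Qed.
Lemma pair_1gE : ((1%g : ({perm V} * {perm V})%type).1 = 1%g) *
  ((1%g : ({perm V} * {perm V})%type).2 = 1%g).
Proof. by []. Qed.
End PairGroup.

Section Isotopisms.
Variables (V : finZmodType).
Local Notation gT := ({perm V} * {perm V})%type.

(** Only the pair (L, M) of an isotopism (N, L, M) is recorded: such pairs lie in the
    finite group of pairs of permutations, where Sylow's theorem applies. *)
Definition isotopisms (f1 f2 : V -> V -> V) : {set gT} :=
  [set g : gT | [&& is_additive g.1, is_additive g.2
    & [exists N : {perm V}, is_additive N &&
        [forall x, forall y, N (f1 x y) == f2 (g.1 x) (g.2 y)]]]].

Lemma isotopismsP f1 f2 (g : gT) :
  reflect [/\ is_additive g.1, is_additive g.2 &
     exists2 N : {perm V}, is_additive N & forall x y, N (f1 x y) = f2 (g.1 x) (g.2 y)]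
   (g \in isotopisms f1 f2).
Proof.
rewrite inE; apply: (iffP and3P) => -[-> -> H]; split=> //.
  have /existsP[N /andP[N_add /forallP HN]] := H; exists N => // x y.
  by have /forallP/(_ y)/eqP := HN x.
have [N N_add HN] := H; apply/existsP; exists N; rewrite N_add.
by apply/forallP => x; apply/forallP => y; rewrite HN.
Qed.

Lemma isotopisms1 f : 1%g \in isotopisms f f.
Proof.
apply/isotopismsP; split; rewrite ?is_additive_perm1 //.
by exists 1%g; rewrite ?is_additive_perm1 // => x y; rewrite ?pair_1gE !perm1.
Qed.

Lemma isotopismsM f1 f2 f3 (g h : gT) : g \in isotopisms f1 f2 ->
  h \in isotopisms f2 f3 -> (g * h)%g \in isotopisms f1 f3.
Proof.
move=> /isotopismsP[g1 g2 [N N_add HN]] /isotopismsP[h1 h2 [P P_add HP]].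
apply/isotopismsP; split; rewrite ?pair_mulgE ?is_additive_permM //.
exists (N * P)%g; rewrite ?is_additive_permM // => x y.
by rewrite ?pair_mulgE !permM HN HP.
Qed.

Lemma isotopismsV f1 f2 (g : gT) : g \in isotopisms f1 f2 -> (g^-1)%g \in isotopisms f2 f1.
Proof.
move=> /isotopismsP[g1 g2 [N N_add HN]].
apply/isotopismsP; split; rewrite ?pair_invgE ?is_additive_permV //.
exists (N^-1)%g; rewrite ?is_additive_permV // => x y.
by apply: (@perm_inj _ N); rewrite permKV HN ?pair_invgE !permKV.
Qed.

Lemma autotopism_group_set f : group_set (isotopisms f f).
Proof. by apply/group_setP; split=> [|g h]; [exact: isotopisms1 | exact: isotopismsM]. Qed.
Canonical autotopism_group f := Group (autotopism_group_set f).

End Isotopisms.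

Section Scalars.
Variables (K : finFieldType).
Local Notation V := (K * K)%type.
Local Notation gT := ({perm V} * {perm V})%type.

Implicit Types g h : gT.

Definition scale (c : K) (X : V) : V := (c * X.1, c * X.2).

Lemma scaleA c d X : scale c (scale d X) = scale (c * d) X.
Proof. by rewrite /scale /= !mulrA. Qed.

Lemma scaleD c X Y : scale c (X + Y) = scale c X + scale c Y.
Proof. by rewrite /scale /= !mulrDr. Qed.

Lemma scaleDl c d X : scale (c + d) X = scale c X + scale d X.
Proof. by rewrite /scale /= !mulrDl. Qed.

Lemma scale1 X : scale 1 X = X.
Proof. by case: X => x y; rewrite /scale /= !mul1r. Qed.

Lemma scale_inj c : c != 0 -> injective (scale c).
Proof. by move=> c_nz [x y] [x' y'] [/(mulfI c_nz) -> /(mulfI c_nz) ->]. Qed.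

Lemma scale_cancel c d X : X != 0 -> scale c X = scale d X -> c = d.
Proof.
case: X => x y; have [-> | x_nz _] := eqVneq x 0; last by case=> /(mulIf x_nz).
by have [-> | y_nz _] := eqVneq y 0; [rewrite eqxx | case=> _ /(mulIf y_nz)].
Qed.

Definition acts_as_scalar (c : K) (g : gT) : bool :=
  [forall X, (g.1 X == scale c X) && (g.2 X == scale c X)].

Lemma acts_as_scalarP c g :
  reflect (forall X, g.1 X = scale c X /\ g.2 X = scale c X) (acts_as_scalar c g).
Proof.
apply: (iffP forallP) => H X; first by have /andP[/eqP-> /eqP->] := H X.
by have [-> ->] := H X; rewrite !eqxx.
Qed.

Definition scalars : {set gT} := [set g | [exists c, (c != 0) && acts_as_scalar c g]].

Lemma scalarsP g :
  reflect (exists2 c, c != 0 & forall X, g.1 X = scale c X /\ g.2 X = scale c X)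
  (g \in scalars).
Proof.
rewrite inE; apply: (iffP existsP) => [[c /andP[c_nz /acts_as_scalarP]]|[c c_nz H]]; exists c => //.
by rewrite c_nz; apply/acts_as_scalarP.
Qed.

Lemma scalars_group_set : group_set scalars.
Proof.
apply/group_setP; split=> [|g h /scalarsP[c c_nz gc] /scalarsP[d d_nz hd]]; apply/scalarsP.
  by exists 1; rewrite ?oner_eq0 // => X; rewrite ?pair_1gE !perm1 scale1.
exists (d * c) => [|X]; first by rewrite mulf_neq0.
by rewrite ?pair_mulgE !permM !(gc _).1 !(gc _).2 (hd _).1 (hd _).2 !scaleA.
Qed.
Canonical scalars_group := Group scalars_group_set.

Lemma scalar_exists c : c != 0 -> exists g : gT, forall X, g.1 X = scale c X /\ g.2 X = scale c X.
Proof.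
by move=> c_nz; exists (perm (scale_inj c_nz), perm (scale_inj c_nz)) => X; rewrite !permE.
Qed.

Lemma scalarX (g : gT) c n : (forall X, g.1 X = scale c X /\ g.2 X = scale c X) ->
  forall X, (g ^+ n)%g.1 X = scale (c ^+ n) X /\ (g ^+ n)%g.2 X = scale (c ^+ n) X.
Proof.
move=> gc; elim: n => [|n IHn] X; first by rewrite ?pair_1gE !perm1 scale1.
by rewrite expgS ?pair_mulgE !permM (gc _).1 (gc _).2 (IHn _).1 (IHn _).2 scaleA -exprSr.
Qed.

Lemma scalars_prime_divisor l (c : K) : prime l -> c ^+ l = 1 -> c != 1 -> (l %| #|scalars|)%N.
Proof.
move=> l_pr cl c1; have c_nz : c != 0.
  by apply: contra_eq_neq cl => ->; rewrite expr0n gtn_eqF ?prime_gt0 // eq_sym oner_eq0.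
have [g gc] := scalar_exists c_nz.
have g_in : g \in scalars by apply/scalarsP; exists c.
have gl : (g ^+ l = 1)%g.
  have e := scalarX l gc; apply/eqP; rewrite -pair_eqE /=.
  apply/andP; split; apply/eqP/permP => X; rewrite perm1.
    by rewrite (e X).1 cl scale1.
  by rewrite (e X).2 cl scale1.
have g1 : g != 1%g.
  apply: contra_neq c1 => g1; apply: (@scale_cancel _ _ (1, 0)).
    by rewrite -pair_eqE /= oner_eq0.
  by rewrite -(gc _).1 g1 ?pair_1gE perm1 scale1.
by rewrite -(nt_prime_order l_pr gl g1) order_dvdG.
Qed.

End Scalars.

(** * Sylow subgroups of autotopism groups *)

Lemma additive0 (U V : finZmodType) (L : U -> V) : is_additive L -> L 0 = 0.
Proof. by move=> /is_additiveP L_add; apply: (addrI (L 0)); rewrite -L_add !addr0. Qed.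

Lemma primitive_prime_dvd (p m l i : nat) : (0 < p)%N -> prime l ->
  m.-primitive_root (p%:R : 'F_l) -> (l %| (p ^ i).-1)%N = (m %| i)%N.
Proof.
by move=> p_gt0 l_pr l_prim; rewrite -expn_eq1_Fp // (prim_order_dvd l_prim).
Qed.

Section Normalizer.
Variables (K : finFieldType) (p m l : nat) (charK : p \in [pchar K]).
Hypotheses (cardK : #|K| = (p ^ m)%N) (l_pr : prime l).
Hypothesis l_prim : m.-primitive_root (p%:R : 'F_l).
Local Notation V := (K * K)%type.
Local Notation gT := ({perm V} * {perm V})%type.
Implicit Types (g h : gT) (Z : {group gT}).

Definition semilinear (i : nat) (g : gT) : Prop := forall (c : K) X,
  g.1 (scale c X) = scale (c ^+ (p ^ i)) (g.1 X) /\
  g.2 (scale c X) = scale (c ^+ (p ^ i)) (g.2 X).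

Lemma semilinearM i j g h : semilinear i g -> semilinear j h -> semilinear (i + j) (g * h)%g.
Proof.
move=> g_i h_j c X; rewrite ?pair_mulgE !permM.
by rewrite (g_i _ _).1 (g_i _ _).2 (h_j _ _).1 (h_j _ _).2 -exprM -expnD.
Qed.

Lemma semilinearX i n g : semilinear i g -> semilinear (i * n) (g ^+ n)%g.
Proof.
move=> g_i; elim: n => [|n IHn].
  by move=> c X; rewrite expg0 !perm1 muln0 !expr1.
by rewrite expgS mulnS; apply: semilinearM.
Qed.

Lemma frob_order n (c : K) : c ^+ (p ^ (n * m)) = c.
Proof.
elim: n => [|n IHn]; first by rewrite expr1.
by rewrite mulSn expnD exprM -cardK expf_card.
Qed.

Lemma l_element_frob (c : K) e i : c ^+ (l ^ e) = 1 -> c != 1 -> c ^+ (p ^ i) = c -> (m %| i)%N.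
Proof.
have p_gt0 : (0 < p)%N by apply: prime_gt0; apply: pcharf_prime charK.
move=> c_l c1 c_i; rewrite -(primitive_prime_dvd _ p_gt0 l_pr l_prim).
have [|o o_prim /(dvdn_pfactor _ _ l_pr)[e' _ def_o]] := prim_order_exists _ c_l.
  by rewrite expn_gt0 prime_gt0.
have c_nz : c != 0.
  by apply: contra_eq_neq c_l => ->; rewrite expr0n gtn_eqF ?expn_gt0 ?prime_gt0 // eq_sym oner_eq0.
have : (o %| (p ^ i).-1)%N.
  rewrite (prim_order_dvd o_prim) -(inj_eq (mulfI c_nz)) -exprS prednK ?expn_gt0 ?p_gt0 //.
  by rewrite c_i mulr1.
apply: dvdn_trans; rewrite def_o.
case: e' def_o => [|e'] def_o; last by rewrite expnS dvdn_mulr.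
by move: c1; rewrite -(prim_expr_order o_prim) def_o expr1 eqxx.
Qed.

(** The elements c for which g (c X) = c' g X, for some c' and all X, form a subring of K.
    It contains the scalars of Z because g normalizes Z, and these generate K. The map
    sending c to c' is then an automorphism of K. *)
Lemma normalizer_semilinear Z g : Z \subset scalars K -> (l.-group Z)%g -> Z :!=: 1%g ->
    is_additive g.1 -> is_additive g.2 -> g \in 'N(Z)%g ->
  exists i : 'I_m, semilinear i g.
Proof.
move=> Z_scal Z_l Z_nt g1_add g2_add g_norm.
have g1D := is_additiveP _ g1_add; have g2D := is_additiveP _ g2_add.
have [z z_Z z1] := trivgPn _ Z_nt.
have [lam lam_nz z_lam] := scalarsP _ (subsetP Z_scal _ z_Z).
have [e z_e] : exists e, (z ^+ (l ^ e) = 1)%g.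
  have /p_natP[e def_e] := mem_p_elt Z_l z_Z; exists e.
  by rewrite -def_e expg_order.
have lam_e : lam ^+ (l ^ e) = 1.
  have v_nz : (1, 0) != 0 :> V by rewrite -pair_eqE /= oner_eq0.
  apply: (scale_cancel v_nz); rewrite -(scalarX (l ^ e) z_lam (1, 0)).1 z_e.
  by rewrite perm1 scale1.
have lam1 : lam != 1.
  apply: contra_neq z1 => lam1; apply/eqP; rewrite -pair_eqE /=.
  apply/andP; split; apply/eqP/permP => X; rewrite perm1.
    by rewrite (z_lam X).1 lam1 scale1.
  by rewrite (z_lam X).2 lam1 scale1.
pose commutes c d :=
  [forall X, (g.1 (scale c X) == scale d (g.1 X)) && (g.2 (scale c X) == scale d (g.2 X))].
have commutesP c d :
    reflect (forall X, g.1 (scale c X) = scale d (g.1 X) /\ g.2 (scale c X) = scale d (g.2 X))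
      (commutes c d).
  apply: (iffP forallP) => H X; first by have /andP[/eqP-> /eqP->] := H X.
  by have [-> ->] := H X; rewrite !eqxx.
have commutesD c d c' d' : commutes c c' -> commutes d d' -> commutes (c + d) (c' + d').
  move=> /commutesP Hc /commutesP Hd; apply/commutesP => X.
  by rewrite !scaleDl g1D g2D !(Hc X).1 !(Hc X).2 !(Hd X).1 !(Hd X).2.
have commutesM c d c' d' : commutes c c' -> commutes d d' -> commutes (c * d) (c' * d').
  move=> /commutesP Hc /commutesP Hd; apply/commutesP => X.
  by rewrite -!scaleA (Hc _).1 (Hc _).2 !(Hd X).1 !(Hd X).2.
have commutes0 : commutes 0 0.
  apply/commutesP => X; have e0 Y : scale 0 Y = 0 :> V by rewrite /scale !mul0r.
  by rewrite !e0 !additive0.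
have commutes1 : commutes 1 1 by apply/commutesP => X; rewrite !scale1.
pose R := [pred c | [exists d, commutes c d]].
have lam_R : lam \in R.
  have zg : (z ^ g)%g \in Z by rewrite memJ_norm.
  have [mu mu_nz zg_mu] := scalarsP _ (subsetP Z_scal _ zg).
  rewrite inE; apply/existsP; exists mu; apply/commutesP => X.
  have zgC : (z * g = g * z ^ g)%g by rewrite conjgC.
  split; first by rewrite -(z_lam X).1 -(zg_mu _).1 -!permM -!pair_mulgE zgC.
  by rewrite -(z_lam X).2 -(zg_mu _).2 -!permM -!pair_mulgE zgC.
have R_full c : exists d, commutes c d.
  apply/existsP; have : c \in R; last by [].
  apply: (subring_full charK cardK _ lam_R).
  - by move=> i; apply: l_element_frob lam_e lam1.
  - by rewrite inE; apply/existsP; exists 0.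
  - by rewrite inE; apply/existsP; exists 1.
  - move=> x y; rewrite !inE => /existsP[x' Hx] /existsP[y' Hy].
    by apply/existsP; exists (x' + y'); apply: commutesD.
  - move=> x y; rewrite !inE => /existsP[x' Hx] /existsP[y' Hy].
    by apply/existsP; exists (x' * y'); apply: commutesM.
have [tau tauP] := fin_all_exists R_full.
have v_nz : g.1 (1, 0) != 0.
  rewrite -(additive0 g1_add) (inj_eq perm_inj) -pair_eqE /= oner_eq0 //.
have uniq_commutes c d d' : commutes c d -> commutes c d' -> d = d'.
  move=> /commutesP/(_ (1, 0))[e1 _] /commutesP/(_ (1, 0))[e2 _].
  by apply: (scale_cancel v_nz); rewrite -e1 -e2.
have tauD x y : tau (x + y) = tau x + tau y.
  by apply: uniq_commutes (tauP _) _; apply: commutesD.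
have tau_zmod : zmod_morphism tau.
  by move=> x y; apply: (addIr (tau y)); rewrite -tauD !subrK.
have tau_monoid : monoid_morphism tau.
  by split=> [|x y]; apply: uniq_commutes (tauP _) _ => //; apply: commutesM.
pose tau_add := GRing.isZmodMorphism.Build K K tau tau_zmod.
pose tau_mul := GRing.isMonoidMorphism.Build K K tau tau_monoid.
pose tau_rm : {rmorphism K -> K} := HB.pack tau tau_add tau_mul.
have [i tau_i] := finField_rmorphism charK tau_rm cardK.
by exists i => c X; have /commutesP/(_ X) := tauP c; rewrite (tau_i c : tau c = _).
Qed.

End Normalizer.

Lemma semilinear_lin2 (K : finFieldType) (L : K * K -> K * K) (tau : K -> K) X :
    is_additive L -> (forall c Y, L (scale c Y) = scale (tau c) (L Y)) ->
  L X = lin2 (L (1, 0)) (L (0, 1)) (tau X.1, tau X.2).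
Proof.
case: X => x y /is_additiveP L_add L_scale.
have XE : (x, y) = scale x (1, 0) + scale y (0, 1).
  by rewrite /scale /= !mulr0 !mulr1; congr (_, _) => /=; rewrite ?addr0 ?add0r.
by rewrite {1}XE L_add !L_scale /scale /lin2 /=; congr (_, _) => /=; ring.
Qed.

Section Autotopisms.
Variables (K : finFieldType) (sig bar : {rmorphism K -> K}).
Hypothesis tw : twist_pair sig bar.
Variables (p m l r : nat) (charK : p \in [pchar K]).
Hypotheses (cardK : #|K| = (p ^ m)%N) (m_gt1 : (1 < m)%N) (l_pr : prime l).
Hypothesis l_prim : m.-primitive_root (p%:R : 'F_l).
(* In the application r is the order of the multiplicative group of the field fixed by
   sig. *)
Hypothesis r_kills : forall k, k != 0 -> sig k = k -> k ^+ r = 1.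
Hypothesis l_r : coprime l r.
Local Notation V := (K * K)%type.
Local Notation gT := ({perm V} * {perm V})%type.
Local Notation mul := (semifield_mul sig bar).
Implicit Types (g h : gT) (B c : K).

Lemma scalars_autotopisms B c : scalars K \subset isotopisms (mul B c) (mul B c).
Proof.
apply/subsetP => g /scalarsP[k k_nz gk].
pose N (X : V) : V := (sig k * k * X.1, bar (sig k) * k * X.2).
have N_inj : injective N.
  have nz1 : sig k * k != 0 by rewrite mulf_neq0 ?fmorph_eq0.
  have nz2 : bar (sig k) * k != 0 by rewrite mulf_neq0 ?fmorph_eq0.
  by move=> [x y] [x' y'] [/(mulfI nz1) -> /(mulfI nz2) ->].
apply/isotopismsP; split.
- by apply/is_additiveP => X Y; rewrite !(gk _).1 scaleD.
- by apply/is_additiveP => X Y; rewrite !(gk _).2 scaleD.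
exists (perm N_inj) => [|X Y].
  by apply/is_additiveP => X Y; rewrite !permE /N /= !mulrDr.
rewrite permE (gk _).1 (gk _).2 /N /semifield_mul /scale /= !rmorphM.
by congr (_, _); ring.
Qed.

Lemma perm_additive_eq0 (L : {perm V}) X : is_additive L -> L X = 0 -> X = 0.
Proof. by move=> L_add; rewrite -{1}(additive0 L_add) => /perm_inj. Qed.

Lemma diagX (L : {perm V}) (a b : K) n : (forall X, L X = (a * X.1, b * X.2)) ->
  forall X, (L ^+ n)%g X = (a ^+ n * X.1, b ^+ n * X.2).
Proof.
move=> L_diag; elim: n => [|n IHn] X; first by rewrite perm1 !mul1r -surjective_pairing.
by rewrite expgSr permM IHn L_diag /= !mulrA -!exprS.
Qed.

Lemma pair_expgE g n : ((g ^+ n)%g.1 = (g.1 ^+ n)%g) * ((g ^+ n)%g.2 = (g.2 ^+ n)%g).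
Proof.
elim: n => [|n [IH1 IH2]]; first by rewrite !expg0.
by rewrite !expgS ?pair_mulgE IH1 IH2.
Qed.

(** An antidiagonal map has a diagonal square. *)
Lemma linear_autotopism_square B c g : admissible bar B c ->
    g \in isotopisms (mul B c) (mul B c) ->
    (forall k X, g.1 (scale k X) = scale k (g.1 X) /\ g.2 (scale k X) = scale k (g.2 X)) ->
  exists l1 l4 m1 m4, [/\ l1 != 0, l4 != 0, m1 != 0,
    forall X, (g ^+ 2)%g.1 X = (l1 * X.1, l4 * X.2)
    & forall X, (g ^+ 2)%g.2 X = (m1 * X.1, m4 * X.2)].
Proof.
move=> adm g_iso g_lin.
have [g1_add g2_add [N _ HN]] := isotopismsP _ _ _ g_iso.
have g1E X : g.1 X = lin2 (g.1 (1, 0)) (g.1 (0, 1)) X.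
  rewrite (semilinear_lin2 (tau := id) X g1_add); first by case: X.
  by move=> k Y; rewrite (g_lin k Y).1.
have g2E X : g.2 X = lin2 (g.2 (1, 0)) (g.2 (0, 1)) X.
  rewrite (semilinear_lin2 (tau := id) X g2_add); first by case: X.
  by move=> k Y; rewrite (g_lin k Y).2.
have squareE (L : {perm V}) X : (L ^+ 2)%g X = L (L X) by rewrite expgS expg1 permM.
suff [l1 [l4 [m1 [m4 [sq1 sq2]]]]] : exists l1 l4 m1 m4,
    (forall X, (g ^+ 2)%g.1 X = (l1 * X.1, l4 * X.2)) /\
    (forall X, (g ^+ 2)%g.2 X = (m1 * X.1, m4 * X.2)).
  have nz (L : {perm V}) (a b : K) :
      is_additive L -> (forall X, L X = (a * X.1, b * X.2)) -> a != 0 /\ b != 0.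
    move=> L_add L_diag; split.
      apply/eqP => a0; have : L (1, 0) = 0 by rewrite L_diag a0 mul0r mulr0.
      by move/(perm_additive_eq0 L_add)/(congr1 fst)/eqP; rewrite oner_eq0.
    apply/eqP => b0; have : L (0, 1) = 0 by rewrite L_diag b0 mul0r mulr0.
    by move/(perm_additive_eq0 L_add)/(congr1 snd)/eqP; rewrite oner_eq0.
  have [l1_nz l4_nz] := nz _ _ _ (is_additive_permM g1_add g1_add) sq1.
  have [m1_nz _] := nz _ _ _ (is_additive_permM g2_add g2_add) sq2.
  by exists l1, l4, m1, m4.
have inj1 X : lin2 (g.1 (1, 0)) (g.1 (0, 1)) X = 0 -> X = 0.
  by rewrite -g1E; apply: perm_additive_eq0.
have inj2 X : lin2 (g.2 (1, 0)) (g.2 (0, 1)) X = 0 -> X = 0.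
  by rewrite -g2E; apply: perm_additive_eq0.
have HN' X Y : N (mul B c X Y) =
    mul B c (lin2 (g.1 (1, 0)) (g.1 (0, 1)) X) (lin2 (g.2 (1, 0)) (g.2 (0, 1)) Y).
  by rewrite HN -g1E -g2E.
move: g1E g2E (linear_shape tw adm inj1 inj2 HN').
case: (g.1 (1, 0)) (g.1 (0, 1)) (g.2 (1, 0)) (g.2 (0, 1)) => [a1 a2] [b1 b2] [a'1 a'2] [b'1 b'2] /=.
move=> g1E g2E [[a0 b0 a'0 b'0]|[a0 b0 a'0 b'0]].
  exists (a1 ^+ 2), (b2 ^+ 2), (a'1 ^+ 2), (b'2 ^+ 2).
  split=> X; rewrite pair_expgE squareE ?(g1E, g2E) /lin2 /= ?a0 ?b0 ?a'0 ?b'0;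
  by rewrite !(mul0r, add0r, addr0) !mulrA -!expr2.
exists (a2 * b1), (a2 * b1), (a'2 * b'1), (a'2 * b'1).
split=> X; rewrite pair_expgE squareE ?(g1E, g2E) /lin2 /= ?a0 ?b0 ?a'0 ?b'0;
by rewrite !(mul0r, add0r, addr0); congr (_, _); ring.
Qed.

Lemma linear_autotopism_power B c g : admissible bar B c ->
    g \in isotopisms (mul B c) (mul B c) ->
    (forall k X, g.1 (scale k X) = scale k (g.1 X) /\ g.2 (scale k X) = scale k (g.2 X)) ->
  (g ^+ (2 * (r * 2)))%g \in scalars K.
Proof.
move=> adm g_iso g_lin.
have [l1 [l4 [m1 [m4 [l1_nz l4_nz m1_nz h1 h2]]]]] := linear_autotopism_square adm g_iso g_lin.
have h_iso : (g ^+ 2)%g \in isotopisms (mul B c) (mul B c) by apply: groupX.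
have [_ _ [N N_add HN]] := isotopismsP _ _ _ h_iso.
have [|l4E m1E m4E] := diagonal_autotopism_power (m4 := m4) tw
  (is_additiveP _ N_add) adm l1_nz l4_nz m1_nz _ r_kills.
  by move=> X Y; rewrite HN h1 h2.
apply/scalarsP; exists (l1 ^+ (r * 2)) => [|X]; first by rewrite expf_neq0.
by rewrite expgM !pair_expgE (diagX _ h1) (diagX _ h2) l4E m1E m4E.
Qed.

(** The m-th power is linear because the field automorphism has order dividing m. *)
Lemma normalizer_power B c (Z : {group gT}) g : admissible bar B c ->
    Z \subset scalars K -> (l.-group Z)%g -> Z :!=: 1%g ->
    g \in 'N_(isotopisms (mul B c) (mul B c))(Z)%g ->
  (g ^+ (m * (2 * (r * 2))))%g \in scalars K.
Proof.
move=> adm Z_scal Z_l Z_nt /setIP[g_iso g_norm].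
have [g1_add g2_add _] := isotopismsP _ _ _ g_iso.
have [i g_i] := normalizer_semilinear charK cardK l_pr l_prim Z_scal Z_l Z_nt g1_add g2_add g_norm.
rewrite expgM; apply: (linear_autotopism_power adm); first exact: groupX.
move=> k X; have [] := semilinearX m g_i k X.
by rewrite (frob_order cardK).
Qed.

Lemma scalars_l_nontrivial (Z : {group gT}) : (l.-Sylow(scalars K) Z)%g -> Z :!=: 1%g.
Proof.
move=> sylZ; have [z z_prim] := finField_primitive_root K.
have c_gt1 : (1 < #|K|)%N := finNzRing_gt1 K.
have p_gt0 : (0 < p)%N by apply: prime_gt0; apply: pcharf_prime charK.
have l_dvd : (l %| #|K|.-1)%N by rewrite cardK (primitive_prime_dvd _ p_gt0 l_pr l_prim).
have l_scal : (l %| #|scalars K|)%N.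
  apply: (@scalars_prime_divisor _ _ (z ^+ (#|K|.-1 %/ l))) => //.
    by rewrite -exprM divnK // prim_expr_order.
  rewrite -(prim_order_dvd z_prim); apply: contraL (prime_gt1 l_pr) => d.
  have q_gt0 : (0 < #|K|.-1 %/ l)%N.
    by rewrite divn_gt0 ?prime_gt0 // dvdn_leq // -ltnS prednK // ltnW.
  have := dvdn_leq q_gt0 d; rewrite -{1}(divnK l_dvd) -[X in (_ <= X)%N]muln1.
  by rewrite leq_pmul2l // leqNgt.
rewrite -cardG_gt1 (card_Hall sylZ) p_part_gt1 mem_primes l_pr cardG_gt0.
exact: l_scal.
Qed.

(** It is enough to show that Z is a Sylow subgroup of its normalizer. There, every
    l-element g has a power g^j in the scalars with j prime to l, so that g itself is a
    scalar. Hence a Sylow l-subgroup containing Z consists of scalars, and equals Z. *)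
Lemma scalars_Sylow B c (Z : {group gT}) : admissible bar B c ->
  (l.-Sylow(scalars K) Z)%g -> (l.-Sylow(isotopisms (mul B c) (mul B c)) Z)%g.
Proof.
move=> adm sylZ; rewrite -Sylow_subnorm.
have Z_nt := scalars_l_nontrivial sylZ.
have Z_l := pHall_pgroup sylZ; have Z_scal := pHall_sub sylZ.
have p_gt0 : (0 < p)%N by apply: prime_gt0; apply: pcharf_prime charK.
have Z_N : Z \subset 'N_(isotopisms (mul B c) (mul B c))(Z)%g.
  by rewrite subsetI normG (subset_trans Z_scal) ?scalars_autotopisms.
have [P sylP sZP] := Sylow_superset Z_N Z_l.
have P_l := pHall_pgroup sylP.
suff /(sub_pHall sylZ P_l sZP)/group_inj PZ : P \subset scalars K by rewrite PZ in sylP.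
apply/subsetP => g gP.
have := normalizer_power adm Z_scal Z_l Z_nt (subsetP (pHall_sub sylP) _ gP).
set j := (m * _)%N => gj.
have l_j : coprime l j.
  have m_lt_l := primitive_root_Fp_lt l_pr l_prim.
  have l_ndvd k : (0 < k < l)%N -> coprime l k.
    move=> /andP[k_gt0 k_lt]; rewrite prime_coprime //.
    by apply: contraL k_lt => /(dvdn_leq k_gt0); rewrite leqNgt.
  by rewrite /j !coprimeMr l_r !l_ndvd ?m_lt_l ?andbT ?(leq_ltn_trans _ m_lt_l) // ltnW.
have g_j : coprime #[g]%g j.
  have /p_natP[e ->] := mem_p_elt P_l gP.
  by rewrite coprimeXl.
move: g_j; rewrite -generator_coprime => /eqP g_gen.
have : g \in <[(g ^+ j)%g]>%g by rewrite -g_gen cycle_id.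
by apply/subsetP; rewrite cycle_subG.
Qed.

(** Conjugation by f carries Z to a Sylow l-subgroup of the second autotopism group,
    which is conjugate to Z there by some x; then f x normalizes Z. *)
Lemma isotopism_semilinear B c1 c2 f : admissible bar B c1 -> admissible bar B c2 ->
    f \in isotopisms (mul B c1) (mul B c2) ->
  exists2 g, g \in isotopisms (mul B c1) (mul B c2) & exists i : 'I_m, semilinear p i g.
Proof.
move=> adm1 adm2 f_iso.
have [Z sylZ] := Sylow_exists l (scalars_group K).
have sylZ2 := scalars_Sylow adm2 sylZ.
have sylZf : (l.-Sylow(isotopisms (mul B c2) (mul B c2)) (Z :^ f))%g.
  rewrite pHallE cardJg; move: sylZ2; rewrite pHallE => /andP[_ ->]; rewrite andbT.
  apply/subsetP => _ /imsetP[z zZ ->]; rewrite conjgE.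
  apply: isotopismsM (isotopismsV f_iso) (isotopismsM _ f_iso).
  apply: (subsetP (scalars_autotopisms B c1)).
  exact: (subsetP (pHall_sub sylZ)).
have [x xG /= defZ] := Sylow_trans sylZf sylZ2.
have fx_iso : (f * x)%g \in isotopisms (mul B c1) (mul B c2) by apply: isotopismsM f_iso xG.
exists (f * x)%g => //.
have [g1_add g2_add _] := isotopismsP _ _ _ fx_iso.
apply: (normalizer_semilinear charK cardK l_pr l_prim (pHall_sub sylZ) (pHall_pgroup sylZ)) => //.
  exact: scalars_l_nontrivial sylZ.
by apply/normP; rewrite conjsgM -defZ.
Qed.

End Autotopisms.

(** * Isotopy classes in the family *)

Section IsotopyClasses.
Variables (K : finFieldType) (sig bar : {rmorphism K -> K}).
Hypothesis tw : twist_pair sig bar.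
Variables (p m l r : nat) (charK : p \in [pchar K]).
Hypotheses (cardK : #|K| = (p ^ m)%N) (m_gt1 : (1 < m)%N) (l_pr : prime l).
Hypothesis l_prim : m.-primitive_root (p%:R : 'F_l).
Hypothesis r_kills : forall k, k != 0 -> sig k = k -> k ^+ r = 1.
Hypothesis l_r : coprime l r.
Variable B : K.
Hypothesis chiB : quad_char B = -1.
Local Notation V := (K * K)%type.
Local Notation gT := ({perm V} * {perm V})%type.
Local Notation mul a := (semifield_mul sig bar B (a / B)).

Definition parameters : {set K} := [set a | (a != 0) && (bar a == a)].

Lemma parameter_admissible a : a \in parameters -> admissible bar B (a / B).
Proof.
have B_nz : B != 0 by apply: (chi_neq0 tw).
by rewrite inE => /andP[a_nz /eqP a_fix]; split; rewrite ?divfK.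
Qed.

(** The value of y * sig y in [linear_isotopism_parameters], after the field automorphism
    of exponent p^i and with flip telling whether the coordinates are exchanged. *)
Definition norm_ratio (i : nat) (flip : bool) : K :=
  if flip then (B * bar B) ^+ (p ^ i) * (B * bar B) else (B * bar B) / (B * bar B) ^+ (p ^ i).

Definition flipped (flip : bool) (a : K) : K := if flip then a^-1 else a.

Lemma isotopic_parameters a1 a2 : a1 \in parameters -> a2 \in parameters ->
    isotopisms (mul a1) (mul a2) != set0 ->
  exists (i : 'I_m) (flip : bool) (y : K),
    y * sig y = norm_ratio i flip /\ a2 = flipped flip (a1 ^+ (p ^ i)) * sig y.
Proof.
move=> a1P a2P /set0Pn[f f_iso].
have adm1 := parameter_admissible a1P; have adm2 := parameter_admissible a2P.
have [g /isotopismsP[g1_add g2_add [N N_add HN]] [i g_i]] :=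
  isotopism_semilinear tw charK cardK m_gt1 l_pr l_prim r_kills l_r adm1 adm2 f_iso.
(* Precomposing with the inverse of tau makes the isotopism linear, and replaces the
   multiplication by its conjugate under tau. *)
pose tau : {rmorphism K -> K} := frob charK i.
have tauE x : tau x = x ^+ (p ^ i) by [].
have [ti tiK tiK'] : bijective tau by apply: injF_bij; exact: fmorph_inj.
have tiD x y : ti (x + y) = ti x + ti y by rewrite -{1}(tiK' x) -{1}(tiK' y) -rmorphD tiK.
have sig_tau x : sig (tau x) = tau (sig x) by rewrite !tauE rmorphXn.
have bar_tau x : bar (tau x) = tau (bar x) by rewrite !tauE rmorphXn.
have N_addE := is_additiveP _ N_add.
pose t2 (X : V) : V := (ti X.1, ti X.2).
have B_nz : B != 0 by apply: (chi_neq0 tw).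
have tB_nz : tau B != 0 by rewrite fmorph_eq0.
have adm1' : admissible bar (tau B) (tau (a1 / B)).
  case: adm1 => _ nz fix_; split; first by rewrite (chi_rmorph tw).
    by rewrite -rmorphM fmorph_eq0.
  by rewrite -rmorphM bar_tau fix_.
have g1E X : g.1 (t2 X) = lin2 (g.1 (1, 0)) (g.1 (0, 1)) X.
  rewrite (semilinear_lin2 (tau := tau) _ g1_add) /=; first by rewrite !tiK'; case: X.
  by move=> k Y; rewrite (g_i k Y).1.
have g2E X : g.2 (t2 X) = lin2 (g.2 (1, 0)) (g.2 (0, 1)) X.
  rewrite (semilinear_lin2 (tau := tau) _ g2_add) /=; first by rewrite !tiK'; case: X.
  by move=> k Y; rewrite (g_i k Y).2.
have t2_eq0 X : t2 X = 0 -> X = 0.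
  by case: X => x y [/(canRL tiK') -> /(canRL tiK') ->]; rewrite rmorph0.
have [||X Y|X Y|y y_fix params] := @linear_isotopism_parameters _ _ _ tw
    (tau B) (tau (a1 / B)) B (a2 / B) (g.1 (1, 0)) (g.1 (0, 1)) (g.2 (1, 0)) (g.2 (0, 1))
    (fun X => N (t2 X)) adm1' adm2.
- by move=> X; rewrite -g1E => /(perm_additive_eq0 g1_add)/t2_eq0.
- by move=> X; rewrite -g2E => /(perm_additive_eq0 g2_add)/t2_eq0.
- rewrite -g1E -g2E -HN; congr (N _).
  rewrite /t2 /semifield_mul /=.
  by congr (_, _); apply: (can_inj tiK); rewrite tiK' !(rmorphD, rmorphM) -?bar_tau -?sig_tau !tiK'.
- by rewrite -N_addE; congr (N _); rewrite /t2 /= !tiD.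
have normB : tau B * bar (tau B) = (B * bar B) ^+ (p ^ i) by rewrite bar_tau -rmorphM.
have normB_nz : (B * bar B) ^+ (p ^ i) != 0 by rewrite expf_neq0 // mulf_neq0 ?fmorph_eq0.
have tau_a1 : tau (a1 / B) * tau B = a1 ^+ (p ^ i) by rewrite -rmorphM divfK.
exists i; case: params => -[]; rewrite normB tau_a1 divfK // => y_eq a_eq.
  exists false, y; split=> //; apply: (mulfI normB_nz).
  by rewrite y_eq /norm_ratio [RHS]mulrC divfK.
by exists true, y.
Qed.

Lemma card_isotopic_parameters a1 : a1 \in parameters ->
  (#|[set a2 in parameters | isotopisms (mul a1) (mul a2) != set0]| <= m * 4)%N.
Proof.
move=> a1P.
pose root i flip := odflt 0 [pick y | (y != 0) && (y * sig y == norm_ratio i flip)].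
pose F (u : 'I_m * (bool * bool)) :=
  flipped u.2.1 (a1 ^+ (p ^ u.1)) * sig ((-1) ^+ u.2.2 * root u.1 u.2.1).
have -> : (m * 4 = #|{: 'I_m * (bool * bool)}|)%N by rewrite !card_prod card_ord card_bool.
apply: leq_trans (leq_imset_card F _); apply: subset_leq_card.
apply/subsetP => a2; rewrite inE => /andP[a2P /(isotopic_parameters a1P a2P)].
case=> i [flip [y [y_eq a2E]]].
have a2_nz : a2 != 0 by move: a2P; rewrite inE => /andP[].
have y_nz : y != 0.
  by apply: contraNneq a2_nz => y0; rewrite a2E y0 rmorph0 mulr0.
have [sgn yE] : exists sgn : bool, y = (-1) ^+ sgn * root i flip.
  rewrite /root; case: pickP => [w /andP[w_nz /eqP w_eq]|/(_ y)]; last by rewrite y_nz y_eq eqxx.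
  have [|->|->] := @sig_norm_inj _ _ _ tw y w w_nz; first by rewrite y_eq w_eq.
    by exists false; rewrite mul1r.
  by exists true; rewrite mulN1r.
by apply/imsetP; exists (i, (flip, sgn)); rewrite // a2E yE.
Qed.

End IsotopyClasses.

(** * The automorphisms of the field with p^(2ds) elements *)

Section FrobeniusTwist.
Variables (K : finFieldType) (p s d : nat).
Hypotheses (p_pr : prime p) (p_odd : odd p).
Hypotheses (s_gt0 : (0 < s)%N) (d_odd : odd d) (d_gt1 : (1 < d)%N).
Hypothesis cardK : #|K| = (p ^ (2 * (d * s)))%N.
Variable charK : p \in [pchar K].
Local Notation sig := (frob charK (2 * s)).
Local Notation bar := (frob charK (d * s)).

Let p_gt1 : (1 < p)%N. Proof. exact: prime_gt1. Qed.

Let exp_dvd i j : (i %| j)%N -> ((p ^ i).-1 %| (p ^ j).-1)%N.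
Proof. by move=> /dvdnP[k ->]; rewrite mulnC expnM (predn_exp (p ^ i)) dvdn_mulr. Qed.

Let frob_comp (x : K) i j : (x ^+ (p ^ i)) ^+ (p ^ j) = x ^+ (p ^ (i + j)).
Proof. by rewrite -exprM -expnD. Qed.

Let frob_iter (x : K) i j : x ^+ (p ^ i) = x -> x ^+ (p ^ (i * j)) = x.
Proof. by move=> xi; elim: j => [|j IHj]; rewrite ?muln0 ?expr1 // mulnS -frob_comp xi. Qed.

Let exprB1 (x : K) n : (0 < n)%N -> x != 0 -> x ^+ n = x -> x ^+ n.-1 = 1.
Proof. by move=> n_gt0 x_nz xn; apply: (mulfI x_nz); rewrite -exprS prednK ?mulr1. Qed.

Let card_half : exists k, (p ^ (d * s) = k.*2.+1)%N /\ ((#|K|.-1)./2 = k.*2 * k.+1)%N.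
Proof.
have P_odd : odd (p ^ (d * s)) by rewrite oddX p_odd orbT.
exists (p ^ (d * s))./2; rewrite -{1}(odd_double_half (p ^ (d * s))) P_odd; split=> //.
rewrite cardK mul2n -addnn expnD -{1 2}(odd_double_half (p ^ (d * s))) P_odd.
move: (p ^ (d * s))./2%N => k.
have -> : (((true + k.*2) * (true + k.*2)).-1 = (k.*2 * k.+1).*2)%N by rewrite -!muln2; lia.
by rewrite doubleK.
Qed.

(** Since d is odd, iterating sig^2 reaches sig, whence sig2_fix; and bar acts as
    x -> x^(p^s) on the field fixed by sig, which has p^(2s) elements. *)
Lemma frobenius_twist_pair : twist_pair sig bar.
Proof.
have [z z_prim] := finField_primitive_root K.
have z_nz : z != 0.
  apply: contra_eq_neq (prim_expr_order z_prim) => ->.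
  by rewrite expr0n gtn_eqF ?(prim_order_gt0 z_prim) // eq_sym oner_eq0.
have odd_d : exists e, (d = e.*2.+1)%N by exists d./2; rewrite -{1}(odd_double_half d) d_odd.
have [e def_d] := odd_d.
have q_gt1 : (1 < p ^ (2 * s))%N by rewrite -(expn0 p) ltn_exp2l // muln_gt0.
split.
- by rewrite cardK oddX p_odd orbT.
- by rewrite -(dvdn_pcharf charK) gtnNdvd // odd_prime_gt2.
- by move=> x; rewrite /= /frob -!exprM mulnC.
- by move=> x; rewrite /= /frob frob_comp addnn -mul2n -cardK expf_card.
- move=> x; rewrite /= /frob frob_comp => xi.
  have := expf_card x; rewrite cardK.
  have -> : (2 * (d * s) = (2 * s + 2 * s) * e + 2 * s)%N by rewrite def_d; lia.
  by rewrite -frob_comp (@frob_iter x _ e xi).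
- have q_dvd : ((p ^ (2 * s)).-1 %| #|K|.-1)%N.
    by rewrite cardK; apply: exp_dvd; rewrite dvdn_pmul2l // dvdn_mull.
  have := dvdn_prim_root z_prim q_dvd.
  set c := z ^+ _ => c_prim; have c_q : c ^+ (p ^ (2 * s)) = c.
    by rewrite -(prednK (ltnW q_gt1)) exprS (prim_expr_order c_prim) mulr1.
  exists c => //; apply/eqP; rewrite /= /frob.
  have -> : (d * s = 2 * s * e + s)%N by rewrite def_d; lia.
  rewrite -frob_comp (@frob_iter c _ e c_q) => c_s.
  have c_nz : c != 0 by rewrite expf_neq0.
  have : (c ^+ (p ^ s).-1 == 1) by rewrite exprB1 // expn_gt0 prime_gt0.
  rewrite -(prim_order_dvd c_prim) => /dvdn_leq.
  have : (p ^ s < p ^ (2 * s))%N by rewrite ltn_exp2l //; lia.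
  have : (1 < p ^ s)%N by rewrite -{1}(expn0 p) ltn_exp2l.
  by move: (p ^ s)%N (p ^ (2 * s))%N; lia.
- exists z; rewrite /= /frob; apply/eqP => z_s.
  have : (z ^+ (p ^ (2 * s)).-1 == 1) by rewrite exprB1 // expn_gt0 prime_gt0.
  rewrite -(prim_order_dvd z_prim) => /dvdn_leq; rewrite cardK.
  have : (p ^ (2 * s) < p ^ (2 * (d * s)))%N by rewrite ltn_exp2l // ltn_pmul2l // ltn_Pmull.
  by move: q_gt1; move: (p ^ (2 * s))%N (p ^ _)%N; lia.
- move=> x x_nz; rewrite /= /frob; have [k [-> half]] := card_half => x_fix.
  by rewrite /quad_char half exprM (exprB1 _ x_nz x_fix) // expr1n.
- move=> x; rewrite /= /frob; have [k [-> half]] := card_half => x_norm.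
  rewrite /quad_char half (_ : (k.*2 * k.+1 = k.*2.+2 * k)%N); last by rewrite -!muln2; lia.
  by rewrite exprM exprS x_norm expr1n.
Qed.

Lemma nonsquare_exists : exists B : K, quad_char B = -1.
Proof.
have tw := frobenius_twist_pair.
have [z z_prim] := finField_primitive_root K; exists z.
have n_gt0 := prim_order_gt0 z_prim.
have z_nz : z != 0.
  apply: contra_eq_neq (prim_expr_order z_prim) => ->.
  by rewrite expr0n gtn_eqF // eq_sym oner_eq0.
case: (chi_cases tw z_nz) => // /eqP; rewrite -(prim_order_dvd z_prim) => d_half.
have c_gt2 := card_gt2 tw; have half_gt0 : (0 < (#|K|.-1)./2)%N.
  by rewrite half_gt0 -ltnS prednK // ltnW // ltnW.
have := dvdn_leq half_gt0 d_half.
by rewrite leqNgt ltn_half_double -addnn -{1}[#|K|.-1]addn0 ltn_add2l n_gt0.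
Qed.

Lemma card_parameters : ((p ^ (d * s)).-1 <= #|parameters bar|)%N.
Proof.
have [z z_prim] := finField_primitive_root K.
set P := (p ^ (d * s))%N.
have P_gt1 : (1 < P)%N by rewrite -(expn0 p) ltn_exp2l // muln_gt0 s_gt0 ltnW.
have P_dvd : (P.-1 %| #|K|.-1)%N.
  by rewrite cardK; apply: exp_dvd; rewrite dvdn_mull.
have w_prim := dvdn_prim_root z_prim P_dvd; set w := z ^+ _ in w_prim.
have w_nz : w != 0.
  apply: contra_eq_neq (prim_expr_order w_prim) => ->.
  by rewrite expr0n gtn_eqF ?(prim_order_gt0 w_prim) // eq_sym oner_eq0.
have wP : w ^+ P = w by rewrite -(prednK (ltnW P_gt1)) exprS (prim_expr_order w_prim) mulr1.
have inj : injective (fun i : 'I_P.-1 => w ^+ i).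
  by move=> i j /eqP; rewrite (eq_prim_root_expr w_prim) !modn_small // => /eqP/val_inj.
rewrite -{1}(card_ord P.-1) -(card_imset _ inj); apply: subset_leq_card.
apply/subsetP => _ /imsetP[i _ ->]; rewrite inE expf_neq0 //= /frob -/P -exprM mulnC exprM.
by rewrite wP.
Qed.

Lemma kills_sig_fixed (k : K) : k != 0 -> sig k = k -> k ^+ (p ^ (2 * s)).-1 = 1.
Proof. by move=> k_nz; apply: exprB1; rewrite // expn_gt0 prime_gt0. Qed.

End FrobeniusTwist.

(** * Families of pairwise unrelated elements *)

Lemma num_pairwise_unrelated_ge (T U : finType) (e : rel U) (S : {set U}) (I : {set T})
    (F : T -> U) :
    reflexive e -> (forall i, i \in I -> F i \in S) ->
    (forall i j, i \in I -> j \in I -> i != j -> ~~ e (F i) (F j)) ->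
  (#|I| <= num_pairwise_unrelated e S)%N.
Proof.
move=> e_refl F_S F_e.
have F_inj : {in I &, injective F}.
  by move=> i j iI jI eqF; apply: contraTeq isT => /(F_e i j iI jI); rewrite eqF e_refl.
rewrite -(card_in_imset F_inj); apply: (leq_bigmax_cond (F := fun A : {set U} => #|A|) (F @: I)).
apply/andP; split; first by apply/subsetP => _ /imsetP[i iI ->]; exact: F_S.
apply/forall_inP => _ /imsetP[i iI ->]; apply/forall_inP => _ /imsetP[j jI ->].
by apply/implyP => neq; apply: F_e => //; apply: contra_neq neq => ->.
Qed.

(** A maximal independent set: each element of A is related to one of its elements. *)
Lemma exists_independent_set (T : finType) (A : {set T}) (e : rel T) (D : nat) :
    reflexive e -> symmetric e -> (forall a, a \in A -> (#|[set b in A | e a b]| <= D)%N) ->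
  exists I : {set T}, [/\ I \subset A, forall i j, i \in I -> j \in I -> i != j -> ~~ e i j
    & (#|A| <= #|I| * D)%N].
Proof.
move=> e_refl e_sym deg.
pose indep (I : {set T}) :=
  (I \subset A) && [forall i in I, forall j in I, (i != j) ==> ~~ e i j].
have indep0 : indep set0.
  by rewrite /indep sub0set; apply/forall_inP => i; rewrite inE.
have [I /maxsetP[/andP[IA /forall_inP I_e] I_max] _] := maxset_exists indep0.
have I_indep i j : i \in I -> j \in I -> i != j -> ~~ e i j.
  by move=> iI jI; have /forall_inP/(_ j jI)/implyP := I_e i iI.
exists I; split=> //.
have cover_A : A \subset \bigcup_(a in I) [set b in A | e a b].
  apply/subsetP => b bA; apply/bigcupP.
  have [bI | b_notin] := boolP (b \in I); first by exists b; rewrite // inE bA e_refl.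
  have [/exists_inP[a aI ab]|/exists_inPn no_a] := boolP [exists a in I, e a b].
    by exists a; rewrite // inE bA.
  case/negP: b_notin; rewrite -(I_max (b |: I)) ?setU11 ?subsetUr //.
  apply/andP; split; first by rewrite subUset sub1set bA.
  apply/forall_inP => i /setU1P[->|iI]; apply/forall_inP => j /setU1P[->|jI]; apply/implyP.
  - by rewrite eqxx.
  - by rewrite e_sym => _; apply: no_a.
  - by move=> _; apply: no_a.
  - exact: I_indep.
apply: leq_trans (subset_leq_card cover_A) _.
apply: (@leq_trans (\sum_(a in I) #|[set b in A | e a b]|)).
  elim/big_rec2: _ => [|a n U _ le_n]; first by rewrite cards0.
  by apply: leq_trans (leq_card_setU _ _) _; rewrite leq_add2l.
rewrite -sum_nat_const; apply: leq_sum => a aI; exact: deg (subsetP IA _ aI).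
Qed.

Lemma Fp_linear_additive (p : nat) (V : finZmodType) (L : V -> V) :
  prime p -> Fp_linear p L -> is_additive L.
Proof.
move=> p_pr /forallP/(_ 1) /forallP L_lin; apply/is_additiveP => x y.
have /forallP/(_ y)/eqP := L_lin x.
have -> : nat_of_ord (1 : 'F_p) = 1%N by rewrite /= Fp_Zcast // modn_small // prime_gt1.
by rewrite !mulr1n.
Qed.

Lemma Fp_linear_perm1 (p : nat) (V : finZmodType) : Fp_linear p (1%g : {perm V}).
Proof. by apply/forallP => c; apply/forallP => x; apply/forallP => y; rewrite !perm1. Qed.

Lemma isotopic_refl (p : nat) (V : finZmodType) (f : V -> V -> V) : isotopic p f f.
Proof.
do 3![apply/existsP; exists 1%g]; rewrite !Fp_linear_perm1 /=.
by apply/forallP => x; apply/forallP => y; rewrite !perm1.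
Qed.

(** * From presemifields to semifields *)

Definition commutative_presemifield (V : finZmodType) (f : V -> V -> V) : Prop :=
  [/\ forall x y, f x y = f y x, forall x y z, f (x + y) z = f x z + f y z
    & forall x y, f x y = 0 -> x = 0 \/ y = 0].

Lemma isotopisms_neq0 (V : finZmodType) (f1 f2 : V -> V -> V) (N L M : V -> V) :
    injective N -> injective L -> injective M ->
    (forall x y, N (x + y) = N x + N y) -> (forall x y, L (x + y) = L x + L y) ->
    (forall x y, M (x + y) = M x + M y) ->
    (forall x y, N (f1 x y) = f2 (L x) (M y)) ->
  isotopisms f1 f2 != set0.
Proof.
move=> N_inj L_inj M_inj ND LD MD HN; apply/set0Pn; exists (perm L_inj, perm M_inj).
apply/isotopismsP; split; first by apply/is_additiveP => x y; rewrite !permE.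
  by apply/is_additiveP => x y; rewrite !permE.
exists (perm N_inj) => [|x y]; last by rewrite !permE.
by apply/is_additiveP => x y; rewrite !permE.
Qed.

Section TransportSemifields.
Variables (V : finZmodType) (p n : nat) (T : finType) (I : {set T}) (f : T -> V -> V -> V).
Local Notation W := 'rV['F_p]_n.
Variables (phi : V -> W) (psi : W -> V) (e : V).
Hypotheses (phiK : cancel phi psi) (psiK : cancel psi phi).
Hypothesis phiD : forall x y, phi (x + y) = phi x + phi y.
Hypothesis f_presemifield : forall i, i \in I -> commutative_presemifield (f i).
Hypothesis f_pairwise :
  forall i j, i \in I -> j \in I -> i != j -> isotopisms (f i) (f j) = set0.
Hypotheses (p_pr : prime p) (e_nz : e != 0).

Let psiD x y : psi (x + y) = psi x + psi y.
Proof. by apply: (can_inj phiK); rewrite phiD !psiK. Qed.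

(** Kaplansky's trick: with R x = x * e, the product of R x and R y is defined to be
    x * y, and then R e is an identity. This does not change the isotopy class. *)
Lemma num_commutative_semifields_ge : (#|I| <= num_commutative_semifields p n)%N.
Proof.
have phi0 : phi 0 = 0 by apply: (addrI (phi 0)); rewrite -phiD !addr0.
have psi0 : psi 0 = 0 by rewrite -phi0 phiK.
have e_inj i : i \in I -> injective (fun x => f i x e).
  move=> iI; have [_ fD f_nz] := f_presemifield iI; move=> x y eq_xy.
  have fN z : f i (- z) e = - f i z e.
    apply: (addrI (f i z e)); rewrite -fD !subrr.
    by apply: (addrI (f i 0 e)); rewrite -fD !addr0.
  have /f_nz[/eqP|e0] : f i (x - y) e = 0 by rewrite fD fN eq_xy subrr.
    by rewrite subr_eq0 => /eqP.
  by move: e_nz; rewrite e0 eqxx.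
have [R RP] : exists R : T -> {perm V}, forall i, i \in I -> forall x, R i x = f i x e.
  apply: (@fin_all_exists T (fun=> {perm V})
    (fun i (R : {perm V}) => i \in I -> forall x, R x = f i x e)) => i.
  have [iI | ] := boolP (i \in I); last by exists 1%g.
  by exists (perm (e_inj i iI)) => _ x; rewrite permE.
pose unit_coord i x := (R i)^-1%g (psi x).
pose F i : {ffun W * W -> W} := [ffun z => phi (f i (unit_coord i z.1) (unit_coord i z.2))].
have unit_coordK i X : unit_coord i (phi (R i X)) = X by rewrite /unit_coord phiK permK.
have unit_coordK' i x : phi (R i (unit_coord i x)) = x by rewrite /unit_coord permKV psiK.
have RD i : i \in I -> forall x y, R i (x + y) = R i x + R i y.
  by move=> iI x y; rewrite !RP //; have [_ ->] := f_presemifield iI.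
have RVD i : i \in I -> forall x y, unit_coord i (x + y) = unit_coord i x + unit_coord i y.
  by move=> iI x y; rewrite /unit_coord psiD; apply: (@perm_inj _ (R i)); rewrite RD // !permKV.
have R0 i : i \in I -> R i 0 = 0.
  by move=> iI; apply: (addrI (R i 0)); rewrite -RD // !addr0.
apply: (@num_pairwise_unrelated_ge _ _ _ _ I F).
- by move=> g; apply: isotopic_refl.
- move=> i iI; have [fC fD f_nz] := f_presemifield iI; rewrite inE.
  apply/andP; split; last first.
    by apply/forallP => x; apply/forallP => y; rewrite !ffunE /= fC.
  apply/and4P; split.
  + apply/forallP => x; apply/forallP => y; apply/forallP => z; rewrite !ffunE /=.
    by rewrite RVD // fC fD phiD ![f i _ (unit_coord i x)]fC.
  + apply/forallP => x; apply/forallP => y; apply/forallP => z; rewrite !ffunE /=.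
    by rewrite RVD // fD phiD.
  + apply/forallP => x; apply/forallP => y; rewrite ffunE /=; apply/implyP => /eqP.
    rewrite -phi0 => /(can_inj phiK)/f_nz[] u0; apply/orP.
      by left; rewrite -(unit_coordK' i x) u0 R0 // phi0.
    by right; rewrite -(unit_coordK' i y) u0 R0 // phi0.
  apply/existsP; exists (phi (R i e)); apply/forallP => x; rewrite !ffunE /= unit_coordK.
  by rewrite fC -RP // unit_coordK' eqxx.
move=> i j iI jI /(f_pairwise iI jI) iso0; apply/negP => /existsP[N /existsP[L /existsP[M]]].
case/and4P => /(Fp_linear_additive p_pr)/is_additiveP ND /(Fp_linear_additive p_pr)/is_additiveP LD
  /(Fp_linear_additive p_pr)/is_additiveP MD /forallP HN.
pose pull (L' : {perm W}) X := unit_coord j (L' (phi (R i X))).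
have pull_inj L' : injective (pull L').
  move=> x y; rewrite /pull /unit_coord.
  by move/perm_inj/(can_inj psiK)/perm_inj/(can_inj phiK)/perm_inj.
have pullD (L' : {perm W}) : (forall x y, L' (x + y) = L' x + L' y) ->
    forall X Y, pull L' (X + Y) = pull L' X + pull L' Y.
  by move=> L'D X Y; rewrite /pull RD // phiD L'D RVD.
suff /eqP : isotopisms (f i) (f j) != set0 by rewrite iso0.
apply: (@isotopisms_neq0 _ _ _ (fun X => psi (N (phi X))) (pull L) (pull M)).
- by move=> x y /(can_inj psiK)/perm_inj/(can_inj phiK).
- exact: pull_inj.
- exact: pull_inj.
- by move=> x y; rewrite phiD ND psiD.
- exact: pullD.
- exact: pullD.
move=> X Y; have /forallP/(_ (phi (R i Y)))/eqP := HN (phi (R i X)).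
by rewrite !ffunE /= !unit_coordK => ->; rewrite phiK.
Qed.

End TransportSemifields.

(** * From presemifields to planar DO maps *)

Lemma finField_rV (p n : nat) (F : finFieldType) : prime p -> #|F| = (p ^ n)%N ->
  exists (phi : 'rV['F_p]_n -> F) (psi : F -> 'rV['F_p]_n),
    [/\ cancel phi psi, cancel psi phi & forall x y, phi (x + y) = phi x + phi y].
Proof.
move=> p_pr cardF; have charF := card_finPcharP cardF p_pr.
pose VT : vectType 'F_p := pPrimeCharType charF.
have dim_n : dim VT = n.
  have : (p ^ dim VT = p ^ n)%N.
    have := card_vspace (fullv : {vspace (pPrimeCharType charF)}).
    by rewrite card_Fp // -cardF dimvf => <-; apply: eq_card => x; rewrite memvf.
  by move/eqP; rewrite eqn_exp2l ?prime_gt1 // => /eqP.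
case: n / dim_n cardF => _.
exists (fun v => r2v v : VT), (@v2r _ VT).
split; [exact: r2vK | exact: v2rK |].
move=> x y.
have H : r2v (x + y) = r2v x + r2v y :> VT.
  by rewrite linearD.
exact H.
Qed.

Section LinearizedPolynomials.
Variables (p n : nat) (F : finFieldType).
Hypotheses (p_pr : prime p) (cardF : #|F| = (p ^ n)%N).
Let charF : p \in [pchar F] := card_finPcharP cardF p_pr.

Lemma additive_basis : exists e : 'I_n -> F, forall (L : F -> F),
  (forall x y, L (x + y) = L x + L y) -> (forall k, L (e k) = 0) -> forall x, L x = 0.
Proof.
have [phi [psi [phiK psiK phiD]]] := finField_rV p_pr cardF.
exists (fun k => phi (delta_mx 0 k)) => L LD L_e x.
pose M v := L (phi v); have MD v w : M (v + w) = M v + M w by rewrite /M phiD LD.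
have M0 : M 0 = 0 by apply: (addrI (M 0)); rewrite -MD !addr0.
rewrite -(psiK x) -/(M (psi x)) (row_sum_delta (psi x)) (big_morph M MD M0) big1 // => k _.
rewrite -[psi x 0 k]natr_Zp scaler_nat.
elim: (nat_of_ord _) => [|j IHj]; first by rewrite mulr0n M0.
by rewrite mulrS MD IHj addr0; apply: L_e.
Qed.

(** A linearized polynomial has degree less than the number of elements of the field. *)
Lemma linearized_eq0 (v : 'I_n -> F) :
  (forall x, \sum_(j < n) v j * x ^+ (p ^ j) = 0) -> forall j, v j = 0.
Proof.
move=> v0 j; pose P : {poly F} := \sum_(j < n) v j *: 'X^(p ^ j).
have n_gt0 : (0 < n)%N by apply: leq_trans (ltn_ord j).
have size_P : (size P <= #|F|)%N.
  apply: leq_trans (size_sum _ _ _) _; apply/bigmax_leqP => i _.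
  apply: leq_trans (size_scale_leq _ _) _; rewrite size_polyXn cardF.
  by rewrite ltn_exp2l ?prime_gt1.
have P0 : P = 0.
  apply: (roots_geq_poly_eq0 (rs := enum F)); rewrite -?cardE ?enum_uniq //.
  apply/allP => x _; rewrite /root horner_sum; apply/eqP; rewrite -[RHS](v0 x).
  by apply: eq_bigr => i _; rewrite hornerZ hornerXn.
have := congr1 (fun Q : {poly F} => Q`_(p ^ j)) P0; rewrite coef0 coef_sum (bigD1 j) //=.
rewrite coefZ coefXn eqxx mulr1 big1 ?addr0 // => i ij.
rewrite coefZ coefXn eqn_exp2l ?prime_gt1 // [(_ == _)]eq_sym.
by rewrite [(_ == _)](negPf (ij : (i : nat) != j)) mulr0.
Qed.

(** On a basis e, the coefficients have to satisfy W^T a W = G, where G is the Gram matrix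
    of beta and W is the Moore matrix of the e_k^(p^j); and W is invertible because a
    linearized polynomial that vanishes on a basis is zero. *)
Lemma biadditive_polynomial (beta : F -> F -> F) :
    (forall x y z, beta (x + y) z = beta x z + beta y z) ->
    (forall x y z, beta x (y + z) = beta x y + beta x z) ->
  exists a : 'M[F]_n, forall x y,
    beta x y = \sum_(i < n) \sum_(j < n) a i j * (x ^+ (p ^ i) * y ^+ (p ^ j)).
Proof.
move=> betaDl betaDr; have [e eP] := additive_basis.
have frobD i x y : (x + y) ^+ (p ^ i) = x ^+ (p ^ i) + y ^+ (p ^ i) :> F.
  exact: (rmorphD (frob charF i)).
pose W := \matrix_(j < n, k < n) (e k) ^+ (p ^ j).
have W_unit : W \in unitmx.
  rewrite -row_free_unit; apply: inj_row_free => v vW0; apply/rowP => j; rewrite mxE.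
  apply: linearized_eq0 j; apply: eP => [x y|k].
    by rewrite -big_split; apply: eq_bigr => j _; rewrite frobD mulrDr.
  have := congr1 (fun u : 'rV_n => u 0 k) vW0; rewrite !mxE => {2}<-.
  by apply: eq_bigr => j _; rewrite mxE.
pose G := \matrix_(k < n, k' < n) beta (e k) (e k').
pose a := (invmx W)^T *m G *m invmx W; exists a.
pose P x y := \sum_(i < n) \sum_(j < n) a i j * (x ^+ (p ^ i) * y ^+ (p ^ j)).
have PDl x y z : P (x + y) z = P x z + P y z.
  rewrite -big_split; apply: eq_bigr => i _; rewrite -big_split; apply: eq_bigr => j _.
  by rewrite frobD /=; ring.
have PDr x y z : P x (y + z) = P x y + P x z.
  rewrite -big_split; apply: eq_bigr => i _; rewrite -big_split; apply: eq_bigr => j _.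
  by rewrite frobD /=; ring.
have P_e k k' : P (e k) (e k') = beta (e k) (e k').
  have <- : (W^T *m a *m W) k k' = beta (e k) (e k').
    by rewrite /a !mulmxA -trmx_mul mulVmx // trmx1 mul1mx mulmxKV // mxE.
  rewrite mxE /P exchange_big; apply: eq_bigr => j _; rewrite !mxE big_distrl.
  by apply: eq_bigr => i _; rewrite !mxE /=; ring.
move=> x y; apply/eqP; rewrite -subr_eq0 -/(P x y); apply/eqP.
move: x; apply: (eP) => [x z|k]; first by rewrite betaDl PDl; ring.
move: y; apply: eP => [y z|k']; first by rewrite betaDr PDr; ring.
by rewrite P_e subrr.
Qed.

End LinearizedPolynomials.

Section TransportDO.
Variables (V : finZmodType) (p n : nat) (F : finFieldType).
Variables (T : finType) (I : {set T}) (f : T -> V -> V -> V).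
Variables (phi : V -> F) (psi : F -> V).
Hypotheses (phiK : cancel phi psi) (psiK : cancel psi phi).
Hypothesis phiD : forall x y, phi (x + y) = phi x + phi y.
Hypothesis f_presemifield : forall i, i \in I -> commutative_presemifield (f i).
Hypothesis f_pairwise :
  forall i j, i \in I -> j \in I -> i != j -> isotopisms (f i) (f j) = set0.
Hypotheses (p_pr : prime p) (p_odd : odd p) (cardF : #|F| = (p ^ n)%N).

Let psiD x y : psi (x + y) = psi x + psi y.
Proof. by apply: (can_inj phiK); rewrite phiD !psiK. Qed.

Lemma DO_equivalent_refl : reflexive (@DO_equivalent p F).
Proof.
move=> g; do 2![apply/existsP; exists 1%g]; rewrite !Fp_linear_perm1 /=.
by apply/forallP => x; rewrite !perm1.
Qed.

(** The polarization of the square of a product is twice the product, which recovers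
    the product in odd characteristic. *)
Lemma num_planar_DO_ge : (#|I| <= num_planar_DO p n F)%N.
Proof.
have charF := card_finPcharP cardF p_pr.
have two_nz : 2 != 0 :> F.
  by rewrite -(dvdn_pcharf charF) gtnNdvd // odd_prime_gt2.
have half (x y : F) : x + x = y + y -> x = y.
  by move=> e; apply: (mulfI two_nz); rewrite !mulr_natl !mulr2n.
have phi0 : phi 0 = 0 by apply: (addrI (phi 0)); rewrite -phiD !addr0.
have psi0 : psi 0 = 0 by rewrite -phi0 phiK.
pose beta i x y := phi (f i (psi x) (psi y)).
have betaC i : i \in I -> forall x y, beta i x y = beta i y x.
  by move=> iI x y; have [fC _ _] := f_presemifield iI; rewrite /beta fC.
have betaDl i : i \in I -> forall x y z, beta i (x + y) z = beta i x z + beta i y z.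
  by move=> iI x y z; have [_ fD _] := f_presemifield iI; rewrite /beta psiD fD phiD.
have betaDr i : i \in I -> forall x y z, beta i z (x + y) = beta i z x + beta i z y.
  by move=> iI x y z; rewrite !(betaC i iI z) betaDl.
pose P i : {ffun F -> F} := [ffun x => beta i x x].
have polar i : i \in I -> forall x y, Delta (P i) x y = beta i x y + beta i x y.
  move=> iI x y; rewrite /Delta !ffunE betaDl // !betaDr // (betaC i iI y x); ring.
apply: (@num_pairwise_unrelated_ge _ _ _ _ I P); first exact: DO_equivalent_refl.
  move=> i iI; rewrite inE; apply/andP; split.
    have [a aP] := biadditive_polynomial p_pr cardF (betaDl i iI) (fun x y z => betaDr i iI y z x).
    apply/existsP; exists a; apply/forallP => x; rewrite ffunE aP; apply/eqP.
    by apply: eq_bigr => k _; apply: eq_bigr => j _; rewrite exprD.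
  apply/forallP => a; apply/implyP => a_nz; apply/forallP => x; apply/implyP.
  rewrite polar // => /eqP; rewrite -[0]addr0 => /half.
  rewrite addr0 /beta -phi0 => /(can_inj phiK).
  have [_ _ f_nz] := f_presemifield iI; case/f_nz => e0.
    by rewrite -(psiK x) e0 phi0.
  by move: a_nz; rewrite -(psiK a) e0 phi0 eqxx.
move=> i j iI jI /(f_pairwise iI jI) iso0; apply/negP => /existsP[L1 /existsP[L2]].
case/and3P => /(Fp_linear_additive p_pr) L1_add /(Fp_linear_additive p_pr) L2_add /forallP HN.
have L1D := is_additiveP _ L1_add; have L2D := is_additiveP _ L2_add.
have L1B x y : L1 (x - y) = L1 x - L1 y by apply: (addIr (L1 y)); rewrite -L1D !subrK.
have HN' x : P i x = L1 (P j (L2 x)) by apply/eqP; apply: HN.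
have key x y : beta i x y = L1 (beta j (L2 x) (L2 y)).
  by apply: half; rewrite -L1D -!polar // /Delta !HN' !L1B L2D.
suff /eqP : isotopisms (f i) (f j) != set0 by rewrite iso0.
have L1V_add := is_additiveP _ (is_additive_permV L1_add).
apply: (@isotopisms_neq0 _ _ _ (fun X => psi ((L1^-1)%g (phi X)))
   (fun X => psi (L2 (phi X))) (fun X => psi (L2 (phi X)))).
- by move=> x y /(can_inj psiK)/perm_inj/(can_inj phiK).
- by move=> x y /(can_inj psiK)/perm_inj/(can_inj phiK).
- by move=> x y /(can_inj psiK)/perm_inj/(can_inj phiK).
- by move=> x y; rewrite phiD L1V_add psiD.
- by move=> x y; rewrite phiD L2D psiD.
- by move=> x y; rewrite phiD L2D psiD.
move=> x y; have := key (phi x) (phi y); rewrite /beta !phiK => ->.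
by rewrite permK phiK.
Qed.

End TransportDO.

(** * The exponential bound *)

Lemma presemifield_family (p s d : nat) :
    prime p -> odd p -> (0 < s)%N -> odd d -> (1 < d)%N ->
  exists (K : finFieldType) (I : {set K}) (f : K -> K * K -> K * K -> K * K),
    [/\ #|K| = (p ^ (2 * (d * s)))%N,
        forall i, i \in I -> commutative_presemifield (f i),
        forall i j, i \in I -> j \in I -> i != j -> isotopisms (f i) (f j) = set0
      & ((p ^ (d * s)).-1 <= #|I| * (2 * (d * s) * 4))%N].
Proof.
move=> p_pr p_odd s_gt0 d_odd d_gt1.
have ds_gt0 : (0 < d * s)%N by rewrite muln_gt0 s_gt0 ltnW.
have m_gt1 : (1 < 2 * (d * s))%N by lia.
have [K charK cardK] := pPrimePowerField p_pr (ltnW m_gt1).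
have tw := frobenius_twist_pair p_pr p_odd s_gt0 d_odd d_gt1 cardK charK.
have [B chiB] := nonsquare_exists p_pr p_odd s_gt0 d_odd d_gt1 cardK charK.
have m_n2 j : (2 * (d * s))%N <> (2 ^ j)%N.
  move=> e; have : (d %| 2 ^ j)%N by rewrite -e mulnCA dvdn_mulr.
  have co : coprime d (2 ^ j) by rewrite coprimeXr // coprimen2.
  by move=> dvd; have := gcdn_idPl dvd; rewrite (eqP co); lia.
have [l l_pr l_prim] := primitive_prime_divisor (odd_prime_gt2 p_odd p_pr) m_n2 (ltnW m_gt1).
have l_r : coprime l (p ^ (2 * s)).-1.
  rewrite prime_coprime // (primitive_prime_dvd _ (prime_gt0 p_pr) l_pr l_prim).
  have ds_gt : (2 * s <= d * s)%N by rewrite leq_mul2r d_gt1 orbT.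
  by apply/negP => /dvdn_leq; lia.
pose sig := frob charK (2 * s); pose bar := frob charK (d * s).
pose f a := semifield_mul sig bar B (a / B).
pose e a b := isotopisms (f a) (f b) != set0.
have e_refl : reflexive e by move=> a; apply/set0Pn; exists 1%g; apply: isotopisms1.
have e_sym : symmetric e.
  by move=> a b; apply/set0Pn/set0Pn => -[g /isotopismsV g_iso]; exists (g^-1)%g.
(* Isotopy is an equivalence relation on the parameters, with classes of at most 4m
   elements. *)
have deg a : a \in parameters bar -> (#|[set b in parameters bar | e a b]| <= 2 * (d * s) * 4)%N.
  apply: (card_isotopic_parameters tw charK cardK m_gt1 l_pr l_prim _ l_r chiB).
  exact: kills_sig_fixed.
have [I [I_sub I_e I_card]] := exists_independent_set e_refl e_sym deg.
exists K, I, f; split=> //.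
- move=> i iI; have adm := parameter_admissible tw chiB (subsetP I_sub i iI).
  split=> [X Y | X Y Z | X Y]; rewrite /f.
  + exact: semifield_mulC.
  + exact: semifield_mulDl.
  exact: (semifield_mul_eq0 tw adm).
- by move=> i j iI jI ij; apply/eqP; have := I_e i j iI jI ij; rewrite negbK.
apply: leq_trans I_card.
exact: card_parameters.
Qed.

Lemma exponential_count (p t k : nat) : (2 < p)%N -> (0 < t)%N ->
  ((p ^ t).-1 <= k * (2 * t * 4))%N -> (2 ^ t <= 32 * k)%N.
Proof.
move=> p_gt2 t_gt0 le_k.
have growth : (t * 2 ^ t <= 4 * (3 ^ t).-1)%N.
  elim: {k le_k} t t_gt0 => // -[|[|t]] IHt _ //.
  have {IHt} := IHt isT; rewrite ![(_ ^ t.+3)%N]expnS.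
  have : (0 < 3 ^ t.+2)%N by rewrite expn_gt0.
  by move: (2 ^ t.+2)%N (3 ^ t.+2)%N => a b; nia.
have le3p : ((3 ^ t).-1 <= (p ^ t).-1)%N by rewrite -!subn1 leq_sub2r // leq_exp2r.
rewrite -(leq_pmul2l t_gt0); apply: leq_trans growth _.
apply: (leq_trans (leq_mul (leqnn 4) (leq_trans le3p le_k))).
by rewrite (_ : 4 * (k * (2 * t * 4)) = t * (32 * k))%N //; ring.
Qed.

Theorem corollary6p5 (R : realType) (p : nat) (p_prime : prime p) (p_odd : odd p) :
  exists C c : R, 0 < C /\ 1 < c /\
    forall t n : nat, (0 < t)%N -> (forall j : nat, t <> (2 ^ j)%N) ->
      n = (4 * t)%N ->
      C * c ^+ n <= (num_commutative_semifields p n)%:R /\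
      (forall K : finFieldType, #|K| = (p ^ n)%N ->
         C * c ^+ n <= (num_planar_DO p n K)%:R).
Proof.
(* The number 9/8 is chosen so that its fourth power is at most 2. *)
exists (1 / 32%:R), (9%:R / 8%:R); split; first by lra.
split; first by lra.
move=> t n t_gt0 t_n2 def_n.
have [d d_odd def_t] := pfactor_coprime (isT : prime 2) t_gt0.
rewrite coprime2n in d_odd; set s := (2 ^ logn 2 t)%N in def_t.
have s_gt0 : (0 < s)%N by rewrite expn_gt0.
have d_gt1 : (1 < d)%N.
  case: d d_odd def_t => [|[|d]] // _ def_t.
  by case: (t_n2 (logn 2 t)); rewrite {1}def_t mul1n.
have [K [I [f [cardK f_pre f_iso I_card]]]] := presemifield_family p_prime p_odd s_gt0 d_odd d_gt1.
rewrite -def_t in cardK I_card.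
have I_large := exponential_count (odd_prime_gt2 p_odd p_prime) t_gt0 I_card.
have bound N : (#|I| <= N)%N -> 1 / 32%:R * (9%:R / 8%:R) ^+ n <= N%:R :> R.
  move=> I_N.
  have c4 : (9%:R / 8%:R) ^+ 4 <= 2%:R :> R by lra.
  have cn : (9%:R / 8%:R) ^+ n <= (2 ^ t)%:R :> R.
    by rewrite def_n exprM natrX lerXn2r ?nnegrE ?exprn_ge0 ?ler0n ?divr_ge0.
  have : (2 ^ t)%:R <= (32 * N)%:R :> R.
    by rewrite ler_nat (leq_trans I_large) // leq_mul2l.
  by rewrite natrM; lra.
have [phi [psi [phiK psiK phiD]]] := finField_rV p_prime cardK.
have psiD x y : psi (x + y) = psi x + psi y by apply: (can_inj phiK); rewrite phiD !psiK.
have nE : n = (2 * t + 2 * t)%N by rewrite def_n; lia.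
pose Phi (X : K * K) : 'rV['F_p]_(2 * t + 2 * t) := row_mx (psi X.1) (psi X.2).
pose Psi (v : 'rV['F_p]_(2 * t + 2 * t)) : K * K := (phi (lsubmx v), phi (rsubmx v)).
have PhiK : cancel Phi Psi by move=> [x y]; rewrite /Psi /Phi /= row_mxKl row_mxKr !psiK.
have PsiK : cancel Psi Phi by move=> v; rewrite /Psi /Phi /= !phiK hsubmxK.
have PhiD X Y : Phi (X + Y) = Phi X + Phi Y by rewrite /Phi /= !psiD add_row_mx.
have e_nz : (1, 0) != 0 :> K * K by rewrite -pair_eqE /= oner_eq0.
split=> [|K' cardK'].
  apply: bound; rewrite nE.
  exact: (num_commutative_semifields_ge PhiK PsiK PhiD f_pre f_iso p_prime e_nz).
apply: bound; rewrite {1}nE in cardK'.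
have [phi' [psi' [phi'K psi'K phi'D]]] := finField_rV p_prime cardK'.
rewrite nE; apply: (@num_planar_DO_ge _ p _ K' _ I f (phi' \o Phi) (Psi \o psi')) => //.
- exact: can_comp.
- exact: can_comp.
by move=> x y /=; rewrite PhiD phi'D.
Qed.
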